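(* Let $G$ be the fundamental group of a closed hyperbolic 3-manifold, equipped with a word metric coming from a finite generating set. Then $\mathbb{Z}^2$ acts translation-like on $G$; that is, there exists a translation-like action of the group $\mathbb{Z}^2$ on the metric space $G$.
   Context: A metric space $X$ is uniformly discrete if $\inf\{d(x,y) : x,y\in X,\ x\neq y\}>0$, and has bounded geometry if for all $r>0$ there is some $N_r>0$ such that every $r$-ball in $X$ has cardinality at most $N_r$. A UDBG space is a metric space that is uniformly discrete and has bounded geometry. A finitely generated group equipped with a word metric $d(g,g')=|g^{-1}g'|_S$ (where $|\cdot|_S$ is word length with respect to a finite generating set $S$) is a UDBG space. A translation-like action of a group $H$ on a UDBG space $X$ is an action of $H$ on the set $X$ such that: (1) the action is free, i.e. for all $x\in X$ and $h\in H$, if $h\cdot x=x$ then $h=1_H$; and (2) for every $h\in H$, the set $\{d(x,h\cdot x) : x\in X\}$ is bounded. (The action is not required to be by isometries or by group homomorphisms.) *)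

(* Defs.v *)
From HB Require Import structures.
From mathcomp Require Import all_boot all_order all_algebra.
From mathcomp Require Import all_classical all_reals.
From mathcomp Require Import ereal topology normedtype exp.
From mathcomp Require Import lra.
Import Order.TTheory GRing.Theory Num.Theory.
Import numFieldNormedType.Exports.
Set Implicit Arguments. Unset Strict Implicit. Unset Printing Implicit Defensive.
Local Open Scope classical_set_scope.
Local Open Scope ring_scope.

Section Loops.
Context {R : realType} {M : topologicalType} (p : M).

(* Only the values on [0, 1] of a loop matter: loops that agree there are
   homotopic. *)
Record loop := Loop {
  loop_fun :> R -> M;
  loop_cts : {within `[0, 1]%classic, continuous loop_fun};
  loop0 : loop_fun 0 = p;
  loop1 : loop_fun 1 = p }.

HB.instance Definition _ := gen_eqMixin loop.
HB.instance Definition _ := gen_choiceMixin loop.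

Definition homotopic (a b : loop) : Prop :=
  exists F : R * R -> M,
    [/\ {within `[0, 1]%classic `*` `[0, 1]%classic, continuous F},
        {in `[0, 1], forall s, F (s, 0) = a s},
        {in `[0, 1], forall s, F (s, 1) = b s} &
        {in `[0, 1], forall t, F (0, t) = p /\ F (1, t) = p}].

End Loops.
Arguments loop R {M} p.

Section Glue.
Context {R : realType}.

Lemma within_comp_continuous (T U V : topologicalType) (A : set U)
    (c : T -> U) (f : U -> V) :
  continuous c -> (forall t, A (c t)) -> {within A, continuous f} ->
  continuous (f \o c).
Proof.
move=> cc Ac /subspace_continuousP cf t.
apply: cvg_comp (cf _ (Ac t)) => P; rewrite /within /= => nP.
have : nbhs t [set s | A (c s) -> P (c s)] := cc t _ nP.
by move=> nt; change (nbhs t (c @^-1` P)); apply: filterS nt => s /= H; exact: H (Ac s).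
Qed.

Lemma glue_continuous (T V : topologicalType) (h : T -> R) (u v : T -> V) :
  continuous h -> continuous u -> continuous v ->
  (forall x, h x = 0 -> u x = v x) ->
  continuous (fun x => if h x <= 0 then u x else v x).
Proof.
move=> ch cu cv uv.
set w := fun x => _.
have cl0 : closed (h @^-1` [set y | y <= 0]).
  by apply: closed_comp; [move=> ? _; exact: ch | exact: closed_le].
have cg0 : closed (h @^-1` [set y | 0 <= y]).
  by apply: closed_comp; [move=> ? _; exact: ch | exact: closed_ge].
have wE : [set: T] = (h @^-1` [set y | y <= 0]) `|` (h @^-1` [set y | 0 <= y]).
  apply/seteqP; split => // x _ /=.
  by have [?|/ltW ?] := leP (h x) 0; [left|right].
apply/continuous_subspace_setT; rewrite wE; apply: withinU_continuous => //.
- apply: (@subspace_eq_continuous _ _ _ u); last exact: continuous_subspaceT.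
  move=> x /[!inE] /= hx; transitivity (w x); last by [].
  by rewrite /w; case: leP hx.
- apply: (@subspace_eq_continuous _ _ _ v); last exact: continuous_subspaceT.
  move=> x /[!inE] /= hx; transitivity (w x); last by [].
  rewrite /w; case: leP => // hx'.
  by rewrite uv//; apply/eqP; rewrite eq_le hx hx'.
Qed.

Definition clamp (t : R) : R := Num.max 0 (Num.min t 1).

Lemma max_cts (T : topologicalType) (f g : T -> R) :
  continuous f -> continuous g -> continuous (fun x => Num.max (f x) (g x)).
Proof. by move=> cf cg x; apply: continuous_max; [exact: cf|exact: cg]. Qed.

Lemma min_cts (T : topologicalType) (f g : T -> R) :
  continuous f -> continuous g -> continuous (fun x => Num.min (f x) (g x)).
Proof. by move=> cf cg x; apply: continuous_min; [exact: cf|exact: cg]. Qed.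

Lemma cst_cts (T : topologicalType) (c : R) : continuous (fun _ : T => c).
Proof. by move=> x; exact: cvg_cst. Qed.

Lemma id_cts (T : topologicalType) : continuous (fun x : T => x).
Proof. by move=> x; exact: cvg_id. Qed.

Lemma add_cts (T : topologicalType) (f g : T -> R) :
  continuous f -> continuous g -> continuous (fun x => f x + g x).
Proof. by move=> cf cg x; apply: cvgD; [exact: cf|exact: cg]. Qed.

Lemma opp_cts (T : topologicalType) (f : T -> R) :
  continuous f -> continuous (fun x => - f x).
Proof. by move=> cf x; apply: cvgN; exact: cf. Qed.

Lemma mul_cts (T : topologicalType) (f g : T -> R) :
  continuous f -> continuous g -> continuous (fun x => f x * g x).
Proof. by move=> cf cg x; apply: cvgM; [exact: cf|exact: cg]. Qed.

Lemma fst_cts (T : topologicalType) : continuous (fun x : R * T => x.1).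
Proof. by move=> x; exact: cvg_fst. Qed.

Lemma snd_cts (T : topologicalType) : continuous (fun x : T * R => x.2).
Proof. by move=> x; exact: cvg_snd. Qed.

Lemma pair_cts (T U V : topologicalType) (f : T -> U) (g : T -> V) :
  continuous f -> continuous g -> continuous (fun x => (f x, g x)).
Proof. by move=> cf cg x; apply: cvg_pair; [exact: cf|exact: cg]. Qed.

Lemma comp_cts (T U V : topologicalType) (f : T -> U) (g : U -> V) :
  continuous g -> continuous f -> continuous (fun x => g (f x)).
Proof. by move=> cg cf x; apply: continuous_comp; [exact: cf|exact: cg]. Qed.

Lemma clamp_cts : continuous clamp.
Proof.
apply: max_cts; first exact: cst_cts.
by apply: min_cts; [exact: id_cts|exact: cst_cts].
Qed.

Lemma clampP t : clamp t \in `[0, 1]%R.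
Proof.
by rewrite in_itv /= /clamp le_max lexx ge_max ler01 ge_min lexx orbT.
Qed.

Lemma clampE t : t \in `[0, 1]%R -> clamp t = t.
Proof. by rewrite in_itv /= => /andP[t0 t1]; rewrite /clamp min_l// max_r. Qed.

Lemma clamp_ge1 t : 1 <= t -> clamp t = 1.
Proof. by move=> t1; rewrite /clamp min_r// max_r. Qed.

Lemma clamp_le0 t : t <= 0 -> clamp t = 0.
Proof.
by move=> t1; rewrite /clamp max_l// ge_min t1.
Qed.
End Glue.

Section FundamentalGroup.
Context {R : realType} {M : topologicalType} (p : M).
Local Notation loop := (loop R p).
Implicit Types a b c : loop.

Arguments loop_cts {R M p} l.

Definition gfun (a : loop) : R -> M := a \o clamp.

Lemma gfun_cts a : continuous (gfun a).
Proof.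
apply: (@within_comp_continuous _ _ _ _ clamp a clamp_cts _ (loop_cts a)).
by move=> t; have := clampP t.
Qed.
Arguments gfun_cts : clear implicits.


Lemma gfunE a t : t \in `[0, 1] -> gfun a t = a t.
Proof. by move=> t01; rewrite /gfun /= clampE. Qed.

Lemma gfun_ge1 a t : 1 <= t -> gfun a t = p.
Proof. by move=> t1; rewrite /gfun /= clamp_ge1// loop1. Qed.

Lemma gfun_le0 a t : t <= 0 -> gfun a t = p.
Proof. by move=> t1; rewrite /gfun /= clamp_le0// loop0. Qed.

Lemma continuous_within (T U : topologicalType) (A : set T) (f g : T -> U) :
  continuous f -> (forall x, A x -> f x = g x) -> {within A, continuous g}.
Proof.
move=> cf fg; apply: (@subspace_eq_continuous _ _ _ f).
  by move=> x /[!inE] /= Ax; exact: fg.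
exact: continuous_subspaceT.
Qed.

Lemma homotopicI (a b : loop) (F : R * R -> M) : continuous F ->
    {in `[0, 1], forall s, F (s, 0) = a s} ->
    {in `[0, 1], forall s, F (s, 1) = b s} ->
    {in `[0, 1], forall t, F (0, t) = p /\ F (1, t) = p} ->
  homotopic a b.
Proof.
by move=> cF F0 F1 Fp; exists F; split => //; exact: continuous_subspaceT.
Qed.

Lemma homotopicE (a b : loop) : homotopic a b ->
  exists F : R * R -> M, [/\ continuous F,
    forall s, F (s, 0) = gfun a s, forall s, F (s, 1) = gfun b s,
    forall s t, s <= 0 -> F (s, t) = p & forall s t, 1 <= s -> F (s, t) = p].
Proof.
move=> [F [cF F0 F1 Fp]].
exists (F \o (fun x => (clamp x.1, clamp x.2))); split => /=.
- apply: (@within_comp_continuous _ _ _ _ (fun x => (clamp x.1, clamp x.2)) F _ _ cF).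
    apply: pair_cts; first exact: (comp_cts clamp_cts (@fst_cts _ _)).
    exact: (comp_cts clamp_cts (@snd_cts _ _)).
  by move=> t; split => /=; have := clampP; apply.
- by move=> s; rewrite (clamp_le0 (lexx _)) F0//; exact: clampP.
- by move=> s; rewrite (clamp_ge1 (lexx _)) F1//; exact: clampP.
- by move=> s t s0; rewrite (clamp_le0 s0); case: (Fp _ (clampP t)).
- by move=> s t s0; rewrite (clamp_ge1 s0); case: (Fp _ (clampP t)).
Qed.

(* Two reparametrizations of one path with the same endpoints are homotopic. *)
Lemma homotopic_reparam (g : R -> M) (f1 f2 : R -> R) (a b : loop) :
  continuous g -> continuous f1 -> continuous f2 ->
  f1 0 = f2 0 -> f1 1 = f2 1 ->
  {in `[0, 1], forall s, g (f1 s) = a s} ->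
  {in `[0, 1], forall s, g (f2 s) = b s} ->
  homotopic a b.
Proof.
move=> cg c1 c2 e0 e1 ga gb.
have i0 : (0 : R) \in `[0, 1] by rewrite in_itv /= lexx ler01.
have i1 : (1 : R) \in `[0, 1] by rewrite in_itv /= lexx ler01.
apply: (@homotopicI _ _
  (fun x => g (f1 x.1 + x.2 * (f2 x.1 - f1 x.1)))).
- apply: comp_cts => //.
  have c1' := comp_cts c1 (@fst_cts R R); have c2' := comp_cts c2 (@fst_cts R R).
  apply: add_cts => //; apply: mul_cts; first exact: snd_cts.
  by apply: add_cts => //; exact: opp_cts.
- by move=> s s01 /=; rewrite mul0r addr0 ga.
- by move=> s s01 /=; rewrite mul1r addrC subrK gb.
- move=> t t01 /=; rewrite e0 e1 !subrr !mulr0 !addr0.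
  by rewrite !gb// loop0 loop1.
Qed.

Definition cat_fun (a b : loop) (t : R) : M :=
  if t <= 2^-1 then a (2 * t) else b (2 * t - 1).

Lemma lin_cts (c d : R) : continuous (fun t : R => c * t + d).
Proof.
apply: add_cts; last exact: cst_cts.
by apply: mul_cts; [exact: cst_cts|exact: id_cts].
Qed.
Arguments lin_cts : clear implicits.


Lemma cat_fun_cts (a b : loop) : {within `[0, 1]%classic, continuous (cat_fun a b)}.
Proof.
refine (@continuous_within _ _ _ (fun t : R =>
  if 2 * t + - 1 <= 0 then gfun a (2 * t + 0) else gfun b (2 * t + - 1)) _ _ _).
  apply: glue_continuous.
  - exact: lin_cts.
  - exact: comp_cts (gfun_cts a) (lin_cts 2 0).
  - exact: comp_cts (gfun_cts b) (lin_cts 2 (- 1)).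
  - by move=> x x0; rewrite gfun_ge1 ?gfun_le0//; lra.
move=> t /=; rewrite in_itv /= => /andP[t0 t1]; rewrite /cat_fun.
have -> : (2 * t + - 1 <= 0) = (t <= 2^-1) by apply/idP/idP => ?; lra.
by case: leP => ht; rewrite gfunE ?addr0// in_itv /=; apply/andP; split; lra.
Qed.
Arguments cat_fun_cts : clear implicits.


Lemma cat_fun0 (a b : loop) : cat_fun a b 0 = p.
Proof. by rewrite /cat_fun invr_ge0 ler0n mulr0 loop0. Qed.

Lemma cat_fun1 (a b : loop) : cat_fun a b 1 = p.
Proof.
rewrite /cat_fun ifF; last by apply/negP => ?; lra.
by rewrite (_ : 2 * 1 - 1 = 1) ?loop1//; lra.
Qed.

Definition loop_cat (a b : loop) : loop :=
  Loop (cat_fun_cts a b) (cat_fun0 a b) (cat_fun1 a b).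

Lemma loop_catE a b t : t \in `[0, 1] ->
  loop_cat a b t = if t <= 2^-1 then gfun a (2 * t) else gfun b (2 * t - 1).
Proof.
rewrite in_itv /= => /andP[t0 t1]; rewrite /loop_cat /= /cat_fun.
by case: leP => ht; rewrite gfunE// in_itv /=; apply/andP; split; lra.
Qed.

Lemma rev_fun_cts (a : loop) :
  {within `[0, 1]%classic, continuous (fun t => a (1 - t))}.
Proof.
refine (@continuous_within _ _ _ (fun t : R => gfun a (- 1 * t + 1)) _ _ _).
  exact: comp_cts (gfun_cts a) (lin_cts (- 1) 1).
move=> t /=; rewrite in_itv /= => /andP[t0 t1].
rewrite gfunE; first by congr (loop_fun a _); lra.
by rewrite in_itv /=; apply/andP; split; lra.
Qed.
Arguments rev_fun_cts : clear implicits.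


Lemma rev_fun0 (a : loop) : a (1 - 0) = p.
Proof. by rewrite subr0 loop1. Qed.

Lemma rev_fun1 (a : loop) : a (1 - 1) = p.
Proof. by rewrite subrr loop0. Qed.

Definition loop_rev (a : loop) : loop :=
  Loop (rev_fun_cts a) (rev_fun0 a) (rev_fun1 a).

Lemma cst_loop_cts : {within `[0, 1]%classic, continuous (fun _ : R => p)}.
Proof. by apply: continuous_subspaceT => x; exact: cvg_cst. Qed.

Definition loop_cst : loop := Loop cst_loop_cts erefl erefl.

Lemma homotopic_refl a : homotopic a a.
Proof.
apply: (@homotopic_reparam (gfun a) id id) => //.
- exact: gfun_cts.
- exact: id_cts.
- exact: id_cts.
- by move=> s; exact: gfunE.
- by move=> s; exact: gfunE.
Qed.

Lemma homotopic_sym a b : homotopic a b -> homotopic b a.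
Proof.
move=> /homotopicE[F [cF F0 F1 Fl Fr]].
apply: (@homotopicI _ _ (fun x => F (x.1, 1 - x.2))).
- apply: comp_cts => //; apply: pair_cts; first exact: fst_cts.
  apply: add_cts; first exact: cst_cts.
  by apply: opp_cts; exact: snd_cts.
- by move=> s s01 /=; rewrite subr0 F1 gfunE.
- by move=> s s01 /=; rewrite subrr F0 gfunE.
- by move=> t t01 /=; rewrite Fl ?Fr.
Qed.

Lemma homotopic_trans b a c :
  homotopic a b -> homotopic b c -> homotopic a c.
Proof.
move=> /homotopicE[F [cF F0 F1 Fl Fr]] /homotopicE[G [cG G0 G1 Gl Gr]].
pose K (u v : R) (H : R * R -> M) := fun x : R * R => H (x.1, u * x.2 + v).
have cK u v H : continuous H -> continuous (K u v H).
  move=> cH; apply: comp_cts => //; apply: pair_cts; first exact: fst_cts.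
  exact: comp_cts (lin_cts u v) (@snd_cts _ _).
apply: (@homotopicI _ _
  (fun x => if 2 * x.2 + - 1 <= 0 then K 2 0 F x else K 2 (- 1) G x)).
- apply: glue_continuous; [|exact: cK|exact: cK|].
    exact: comp_cts (lin_cts _ _) (@snd_cts _ _).
  move=> [s t] /= h0; rewrite /K /= h0 (_ : 2 * t + 0 = 1) ?F1 ?G0//; lra.
- by move=> s s01 /=; rewrite /K /= ifT ?mulr0 ?addr0 ?F0 ?gfunE//; lra.
- move=> s s01 /=; rewrite /K /= ifF; last by apply/negP => ?; lra.
  by rewrite (_ : 2 * 1 + - 1 = 1) ?G1 ?gfunE//; lra.
- by move=> t t01 /=; rewrite /K /=; split; case: ifP => _;
  rewrite ?(Fl 0) ?(Gl 0) ?(Fr 1) ?(Gr 1).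
Qed.

Lemma homotopic_cat a a' b b' : homotopic a a' -> homotopic b b' ->
  homotopic (loop_cat a b) (loop_cat a' b').
Proof.
move=> /homotopicE[F [cF F0 F1 Fl Fr]] /homotopicE[G [cG G0 G1 Gl Gr]].
pose K (u v : R) (H : R * R -> M) := fun x : R * R => H (u * x.1 + v, x.2).
have cK u v H : continuous H -> continuous (K u v H).
  move=> cH; apply: comp_cts => //; apply: pair_cts; last exact: snd_cts.
  exact: comp_cts (lin_cts u v) (@fst_cts _ _).
have hE (t : R) : (2 * t + - 1 <= 0) = (t <= 2^-1).
  by apply/idP/idP => ?; lra.
apply: (@homotopicI _ _
  (fun x => if 2 * x.1 + - 1 <= 0 then K 2 0 F x else K 2 (- 1) G x)).
- apply: glue_continuous; [|exact: cK|exact: cK|].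
    exact: comp_cts (lin_cts _ _) (@fst_cts _ _).
  by move=> [s t] /= h0; rewrite /K /= Fr ?Gl//; lra.
- by move=> s s01; rewrite loop_catE// /K /= hE addr0 F0 G0.
- by move=> s s01; rewrite loop_catE// /K /= hE addr0 F1 G1.
- move=> t t01; rewrite /K /= !hE; split.
    by rewrite ifT ?Fl//; lra.
  by rewrite ifF ?Gr//; [lra|apply/negP => ?; lra].
Qed.

Lemma homotopic_rev a a' :
  homotopic a a' -> homotopic (loop_rev a) (loop_rev a').
Proof.
move=> /homotopicE[F [cF F0 F1 Fl Fr]].
have i01 (s : R) : s \in `[0, 1] -> 1 - s \in `[0, 1].
  by rewrite !in_itv /= => /andP[s0 s1]; apply/andP; split; lra.
apply: (@homotopicI _ _ (fun x => F (1 - x.1, x.2))).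
- apply: comp_cts => //; apply: pair_cts; last exact: snd_cts.
  apply: add_cts; first exact: cst_cts.
  by apply: opp_cts; exact: fst_cts.
- by move=> s s01 /=; rewrite F0 gfunE// i01.
- by move=> s s01 /=; rewrite F1 gfunE// i01.
- by move=> t t01 /=; rewrite subr0 subrr (Fl 0) ?(Fr 1).
Qed.

Lemma homotopic_catA a b c :
  homotopic (loop_cat a (loop_cat b c)) (loop_cat (loop_cat a b) c).
Proof.
pose g (s : R) := if 1 * s + - 1 <= 0 then gfun a s else
  if 1 * s + - 2 <= 0 then gfun b (1 * s + - 1) else gfun c (1 * s + - 2).
have cg : continuous g.
  apply: glue_continuous; [exact: lin_cts|exact: gfun_cts| |].
    apply: glue_continuous; first exact: lin_cts.
    - exact: comp_cts (gfun_cts b) (lin_cts _ _).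
    - exact: comp_cts (gfun_cts c) (lin_cts _ _).
    - by move=> x x0; rewrite gfun_ge1 ?gfun_le0//; lra.
  move=> x x0; rewrite ifT; last lra.
  by rewrite gfun_ge1 ?gfun_le0//; lra.
apply: (@homotopic_reparam g
  (fun s => Num.max (2 * s + 0) (4 * s + - 1))
  (fun s => Num.min (4 * s + 0) (2 * s + 1))) => //.
- by apply: max_cts; exact: lin_cts.
- by apply: min_cts; exact: lin_cts.
- by rewrite max_l ?min_l; lra.
- by rewrite max_r ?min_r; lra.
- move=> s s01; rewrite loop_catE//.
  have /andP[s0 s1] : 0 <= s <= 1 by move: s01; rewrite in_itv.
  rewrite /g; cbv beta.
  case: (leP s 2^-1) => hs.
    by rewrite max_l ?addr0; [rewrite ifT//; lra|lra].
  rewrite max_r; last lra.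
  rewrite ifF; last by apply/negP => ?; lra.
  have i1 : 2 * s - 1 \in `[0, 1] by rewrite in_itv /=; apply/andP; split; lra.
  rewrite [in RHS]gfunE// loop_catE//.
  case: (leP (2 * s - 1) 2^-1) => hs2.
    by rewrite ifT; [congr (gfun b _); lra|lra].
  rewrite ifF; last by apply/negP => ?; lra.
  by congr (gfun c _); lra.
- move=> s s01; rewrite loop_catE//.
  have /andP[s0 s1] : 0 <= s <= 1 by move: s01; rewrite in_itv.
  rewrite /g; cbv beta.
  case: (leP s 2^-1) => hs.
    rewrite min_l; last lra.
    have i1 : 2 * s \in `[0, 1] by rewrite in_itv /=; apply/andP; split; lra.
    rewrite [in RHS]gfunE// loop_catE//.
    case: (leP (2 * s) 2^-1) => hs2.
      by rewrite ifT; [congr (gfun a _); lra|lra].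
    rewrite ifF; last by apply/negP => ?; lra.
    by rewrite ifT; [congr (gfun b _); lra|lra].
  rewrite min_r; last lra.
  rewrite ifF; last by apply/negP => ?; lra.
  rewrite ifF; last by apply/negP => ?; lra.
  by congr (gfun c _); lra.
Qed.

Lemma homotopic_cat1l a : homotopic (loop_cat loop_cst a) a.
Proof.
apply: (@homotopic_reparam (gfun a) (fun s => Num.max 0 (2 * s + - 1)) id).
- exact: gfun_cts.
- by apply: max_cts; [exact: cst_cts|exact: lin_cts].
- exact: id_cts.
- by rewrite max_l//; lra.
- by rewrite max_r//; lra.
- move=> s s01; rewrite loop_catE//.
  have /andP[s0 s1] : 0 <= s <= 1 by move: s01; rewrite in_itv.
  case: (leP s 2^-1) => hs; last by rewrite max_r//; lra.
  by rewrite max_l; [rewrite gfun_le0|lra].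
- by move=> s s01; rewrite gfunE.
Qed.

Lemma homotopic_cat1r a : homotopic (loop_cat a loop_cst) a.
Proof.
apply: (@homotopic_reparam (gfun a) (fun s => Num.min (2 * s + 0) 1) id).
- exact: gfun_cts.
- by apply: min_cts; [exact: lin_cts|exact: cst_cts].
- exact: id_cts.
- by rewrite min_l//; lra.
- by rewrite min_r//; lra.
- move=> s s01; rewrite loop_catE//.
  have /andP[s0 s1] : 0 <= s <= 1 by move: s01; rewrite in_itv.
  case: (leP s 2^-1) => hs; first by rewrite min_l ?addr0//; lra.
  by rewrite min_r; [rewrite gfun_ge1|lra].
- by move=> s s01; rewrite gfunE.
Qed.

Lemma homotopic_catV a : homotopic (loop_cat a (loop_rev a)) loop_cst.
Proof.
apply: (@homotopic_reparam (gfun a)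
  (fun s => Num.min (2 * s + 0) (- 2 * s + 2)) (fun=> 0)).
- exact: gfun_cts.
- by apply: min_cts; exact: lin_cts.
- exact: cst_cts.
- by rewrite min_l; lra.
- by rewrite min_r; lra.
- move=> s s01; rewrite loop_catE//.
  have /andP[s0 s1] : 0 <= s <= 1 by move: s01; rewrite in_itv.
  case: (leP s 2^-1) => hs; first by rewrite min_l ?addr0//; lra.
  rewrite min_r; last lra.
  rewrite !gfunE /=; first by congr (loop_fun a _); lra.
    by rewrite in_itv /=; apply/andP; split; lra.
  by rewrite in_itv /=; apply/andP; split; lra.
- by move=> s s01; rewrite gfun_le0.
Qed.

Lemma homotopic_catVl a : homotopic (loop_cat (loop_rev a) a) loop_cst.
Proof.
apply: (@homotopic_reparam (gfun a)
  (fun s => Num.max (- 2 * s + 1) (2 * s + - 1)) (fun=> 1)).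
- exact: gfun_cts.
- by apply: max_cts; exact: lin_cts.
- exact: cst_cts.
- by rewrite max_l; lra.
- by rewrite max_r; lra.
- move=> s s01; rewrite loop_catE//.
  have /andP[s0 s1] : 0 <= s <= 1 by move: s01; rewrite in_itv.
  case: (leP s 2^-1) => hs; last by rewrite max_r//; lra.
  rewrite max_l; last lra.
  rewrite !gfunE /=; first by congr (loop_fun a _); lra.
    by rewrite in_itv /=; apply/andP; split; lra.
  by rewrite in_itv /=; apply/andP; split; lra.
- by move=> s s01; rewrite gfun_ge1.
Qed.

Definition homotopicb (a b : loop) : bool := `[< homotopic a b >].

Lemma homotopicb_equiv : equiv_class_of homotopicb.
Proof.
split=> [a|a b|b a c].
- by apply/asboolP; exact: homotopic_refl.
- by apply/asboolP/asboolP; exact: homotopic_sym.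
- by move=> /asboolP ab /asboolP bc; apply/asboolP; exact: homotopic_trans ab bc.
Qed.

Canonical homotopic_equiv := EquivRelPack homotopicb_equiv.

Local Open Scope quotient_scope.

Definition pi1 : Type := {eq_quot homotopic_equiv}.

HB.instance Definition _ := Choice.on pi1.
HB.instance Definition _ := EqQuotient.on pi1.

Lemma pi1P a b : \pi_pi1 a = \pi_pi1 b <-> homotopic a b.
Proof. split; first by move=> /eqmodP /asboolP.
by move=> ab; apply/eqmodP; apply/asboolP. Qed.

Lemma pi1_surj (x : pi1) : exists a, x = \pi_pi1 a.
Proof. by exists (repr x); rewrite reprK. Qed.

Lemma repr_pi1 a : homotopic (repr (\pi_pi1 a)) a.
Proof. by apply/pi1P; rewrite reprK. Qed.

Definition pi1_mul (x y : pi1) : pi1 := \pi_pi1 (loop_cat (repr x) (repr y)).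
Definition pi1_one : pi1 := \pi_pi1 loop_cst.
Definition pi1_inv (x : pi1) : pi1 := \pi_pi1 (loop_rev (repr x)).

Lemma pi1_mulE a b : pi1_mul (\pi_pi1 a) (\pi_pi1 b) = \pi_pi1 (loop_cat a b).
Proof. by apply/pi1P; apply: homotopic_cat; exact: repr_pi1. Qed.

Lemma pi1_invE a : pi1_inv (\pi_pi1 a) = \pi_pi1 (loop_rev a).
Proof. by apply/pi1P; apply: homotopic_rev; exact: repr_pi1. Qed.

Lemma pi1_mulA : associative pi1_mul.
Proof.
move=> x y z; have [a ->] := pi1_surj x; have [b ->] := pi1_surj y.
have [c ->] := pi1_surj z; rewrite !pi1_mulE.
by apply/pi1P; exact: homotopic_catA.
Qed.

Lemma pi1_mul1g : left_id pi1_one pi1_mul.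
Proof.
by move=> x; have [a ->] := pi1_surj x; rewrite /pi1_one pi1_mulE; apply/pi1P; exact: homotopic_cat1l.
Qed.

Lemma pi1_mulg1 : right_id pi1_one pi1_mul.
Proof.
by move=> x; have [a ->] := pi1_surj x; rewrite /pi1_one pi1_mulE; apply/pi1P; exact: homotopic_cat1r.
Qed.

Lemma pi1_mulVg : left_inverse pi1_one pi1_inv pi1_mul.
Proof.
move=> x; have [a ->] := pi1_surj x; rewrite pi1_invE pi1_mulE.
by apply/pi1P; exact: homotopic_catVl.
Qed.

Lemma pi1_mulgV : right_inverse pi1_one pi1_inv pi1_mul.
Proof.
move=> x; have [a ->] := pi1_surj x; rewrite pi1_invE pi1_mulE.
by apply/pi1P; exact: homotopic_catV.
Qed.

HB.instance Definition _ := isGroup.Build pi1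
  pi1_mulA pi1_mul1g pi1_mulg1 pi1_mulVg pi1_mulgV.

End FundamentalGroup.
Arguments pi1 R {M} p.

(* The upper half-space model of hyperbolic 3-space. *)
Record hyp3 (R : realType) := Hyp3 {
  hyp3_x : R; hyp3_y : R; hyp3_z : R; hyp3_z_gt0 : 0 < hyp3_z }.

Definition arcosh (R : realType) (x : R) : R := ln (x + Num.sqrt (x ^+ 2 - 1)).

Definition hyp3_dist (R : realType) (p q : hyp3 R) : R :=
  arcosh (1 + ((hyp3_x p - hyp3_x q) ^+ 2 + (hyp3_y p - hyp3_y q) ^+ 2 +
               (hyp3_z p - hyp3_z q) ^+ 2) / (2 * hyp3_z p * hyp3_z q)).

(* Some ball around every point is isometric to a ball of hyperbolic
   3-space. *)
Definition locally_hyp3 (R : realType) (M : metricType R) : Prop :=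
  forall x : M, exists r : R, exists f : M -> hyp3 R,
    [/\ 0 < r,
        forall y z, ball x r y -> ball x r z ->
          hyp3_dist (f y) (f z) = mdist y z &
        f @` ball x r = [set q | hyp3_dist (f x) q < r]].

(* Completeness of the metric follows from compactness. *)
Definition closed_hyperbolic_3manifold (R : realType) (M : metricType R) :
    Prop :=
  [/\ compact [set: M], connected [set: M] & locally_hyp3 M].

HB.mixin Record Metric_isUDBG (R : realType) X of Metric R X := {
  uniformly_discrete : (0 < ereal_inf
    [set (mdist x.1 x.2)%:E | x in [set x : X * X | x.1 <> x.2]])%E;
  bounded_geometry : forall r : R, 0 < r ->
    exists N : nat, forall x : X, (ball x r #<= `I_N)%card
}.

#[short(type="udbgType")]
HB.structure Definition UDBG (R : realType) :=
  { X of Metric R X & Metric_isUDBG R X }.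

(* The action need not be isometric: only freeness and bounded displacement
   of each element are required. *)
Definition translation_like (H : groupType) (R : realType) (X : udbgType R)
    (act : H -> X -> X) : Prop :=
  [/\ forall x, act 1%g x = x,
      forall g h x, act (g * h)%g x = act g (act h x),
      forall x h, act h x = x -> h = 1%g &
      forall h, bounded_set [set mdist x (act h x) | x in [set: X]]].

(* The alphabet of a word is S together with the inverses of S. *)
Section WordLength.
Context {G : groupType} (S : seq G).
Implicit Types (w : seq G) (g h : G).

Definition is_word w := all (fun x => (x \in S) || (x^-1%g \in S)) w.

Definition word_of_size g n :=
  exists w, [/\ is_word w, (\prod_(x <- w) x)%g = g & size w = n].

Definition generates := forall g, exists n, word_of_size g n.

Context (genS : generates).

Lemma generates_asbool g : exists n, `[< word_of_size g n >].
Proof. by have [n gn] := genS g; exists n; apply/asboolP. Qed.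

Definition word_length g := ex_minn (generates_asbool g).

Lemma word_lengthP g : word_of_size g (word_length g).
Proof. by rewrite /word_length; case: ex_minnP => n /asboolP. Qed.

Lemma word_length_min g n : word_of_size g n -> (word_length g <= n)%N.
Proof.
by rewrite /word_length; case: ex_minnP => m _ mn gn; apply/mn/asboolP.
Qed.

Lemma word_length1 : word_length 1%g = 0%N.
Proof.
apply/eqP; rewrite -leqn0; apply: word_length_min.
by exists [::]; rewrite big_nil.
Qed.

Lemma word_length_eq0 g : word_length g = 0%N -> g = 1%g.
Proof.
move=> g0; have [w [_ wE /eqP]] := word_lengthP g.
by rewrite g0 size_eq0 => /eqP w0; rewrite -wE w0 big_nil.
Qed.

Lemma word_lengthM g h :
  (word_length (g * h)%g <= word_length g + word_length h)%N.
Proof.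
have [v [Sv vE <-]] := word_lengthP g; have [w [Sw wE <-]] := word_lengthP h.
apply: word_length_min; exists (v ++ w); split.
- by rewrite /is_word all_cat; apply/andP.
- by rewrite big_cat /= vE wE.
- by rewrite size_cat.
Qed.

Lemma word_of_sizeV g n : word_of_size g n -> word_of_size g^-1%g n.
Proof.
move=> [w [Sw <- <-]]; exists (rev [seq x^-1%g | x <- w]); split.
- rewrite /is_word all_rev all_map; apply: sub_all Sw => x /=.
  by rewrite invgK orbC.
- elim: w {Sw} => [|x w IHw]; first by rewrite !big_nil invg1.
  by rewrite /= rev_cons -cats1 big_cat big_seq1 /= IHw big_cons invgM.
- by rewrite size_rev size_map.
Qed.

Lemma word_lengthV g : word_length g^-1%g = word_length g.
Proof.
have le h : (word_length h^-1%g <= word_length h)%N.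
  exact/word_length_min/word_of_sizeV/word_lengthP.
by apply/eqP; rewrite eqn_leq le /= -[X in (word_length X <= _)%N]invgK le.
Qed.

Lemma word_ball_card n : exists N : nat, forall x,
  ([set y | (word_length (x^-1 * y)%g <= n)%N] #<= `I_N)%card.
Proof.
pose A := S ++ [seq x^-1%g | x <- S]; pose k := size A.
pose T : finType := n.-tuple 'I_k.+1.
exists #|T| => x.
pose f (t : T) := (x * \prod_(i <- (t : n.-tuple 'I_k.+1)) nth 1 A i)%g.
apply: (@card_le_trans _ _ _ ((f \o enum_val) @` [set: 'I_#|T|])); last first.
  apply: card_le_trans (card_image_le _ _) _.
  by have := @card_II #|T|; rewrite card_eq_sym => /card_eqPle[].
apply: subset_card_le => y /= yn.
have [w [Sw wE wn]] := word_lengthP (x^-1 * y)%g.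
pose s := [seq inord (index x A) : 'I_k.+1 | x <- w] ++ nseq (n - size w) ord_max.
have sn : size s == n by rewrite size_cat size_map size_nseq subnKC// wn.
exists (enum_rank (Tuple sn)) => //.
rewrite /= enum_rankK /f /= big_cat big_map /= [X in (_ * (_ * X))%g]big1_seq; last first.
  by move=> i /= /nseqP[-> _]; rewrite nth_default.
rewrite mulg1 -[RHS](mulVKg x) -wE; congr (x * _)%g.
apply: eq_big_seq => z zw; rewrite inordK ?ltnS ?index_size// nth_index//.
have := allP Sw _ zw; rewrite /A mem_cat => /orP[->//|zS].
by apply/orP; right; apply/mapP; exists z^-1%g; rewrite ?invgK.
Qed.

End WordLength.

(* The group G viewed as a metric space, with the left-invariant distance
   |x^-1 y|. *)
Definition word_space (R : realType) (G : groupType) (S : seq G)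
  (genS : generates S) : Type := G.

Section WordMetric.
Context (R : realType) (G : groupType) (S : seq G) (genS : generates S).
Local Notation X := (word_space R genS).

Definition word_dist (x y : X) : R :=
  (word_length genS ((x : G)^-1 * (y : G))%g)%:R.

Lemma word_distxx x : word_dist x x = 0.
Proof. by rewrite /word_dist mulVg word_length1. Qed.

Lemma word_dist_eq0 x y : word_dist x y = 0 -> x = y.
Proof.
move=> /eqP; rewrite pnatr_eq0 => /eqP/word_length_eq0 xy.
by rewrite -[RHS](mulVKg (x : G)) xy mulg1.
Qed.

Lemma word_dist_sym x y : word_dist x y = word_dist y x.
Proof. by rewrite /word_dist -word_lengthV invgM invgK. Qed.

Lemma word_dist_triangle y x z : word_dist x z <= word_dist x y + word_dist y z.
Proof.
rewrite /word_dist -natrD ler_nat.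
have -> : ((x : G)^-1 * z = ((x : G)^-1 * y) * ((y : G)^-1 * z))%g.
  by rewrite mulgA mulgK.
exact: word_lengthM.
Qed.

HB.instance Definition _ := Choice.copy X G.
HB.instance Definition _ :=
  isMetric.Build R X word_distxx word_dist_eq0 word_dist_sym word_dist_triangle.

Lemma word_space_uniformly_discrete : (0 < ereal_inf
  [set (mdist x.1 x.2)%:E | x in [set x : X * X | x.1 <> x.2]])%E.
Proof.
apply: (@lt_le_trans _ _ 1%:E); first by rewrite lte_fin.
apply: le_ereal_inf_tmp => _ [[x y] /= xy <-].
rewrite lee_fin /mdist/= /word_dist ler1n lt0n; apply/eqP => w0.
by apply: xy; apply: word_dist_eq0; rewrite /word_dist w0.
Qed.

Lemma word_space_bounded_geometry (r : R) : 0 < r ->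
  exists N : nat, forall x : X, (ball x r #<= `I_N)%card.
Proof.
move=> r0; have [N NP] := word_ball_card genS (Num.truncn r).+1.
exists N => x; apply: card_le_trans (NP x).
apply: subset_card_le => y; rewrite ballEmdist /= => xy.
rewrite -(ler_nat R); apply: ltW; apply: lt_trans xy _.
by rewrite truncnS_gt.
Qed.

HB.instance Definition _ := Metric_isUDBG.Build R X
  word_space_uniformly_discrete word_space_bounded_geometry.

End WordMetric.

(* Main.v *)
Require Import Defs.
From mathcomp Require Import all_boot all_order all_algebra.
From mathcomp Require Import all_classical all_reals.
From mathcomp Require Import ereal topology normedtype sequences exp.
From mathcomp Require Import ring lra zify.
(* The charts of M develop to a local isometry cov from the upper half-space H
   onto M with the path lifting property, so that sending a loop class to the
   endpoint of its lift gives a map phi : pi_1(M) -> H whose image is coarsely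
   dense and which is uniformly proper for the word metric.  The points
   (c a l^k, c b l^k, l^k) of H, for integers a, b, k, form another coarsely
   dense set, preserved by the horospherical translations of (a, b) by Z^2,
   which have bounded displacement.  For c and l large this set is so sparse
   that moving each of its points to a nearby point of the image of phi is
   injective.  Conversely pi_1(M) maps to it with fibers of bounded size N, and
   as each of its points has l^m >= N neighbours at level k - m that are
   neighbours of no other point at level k, this map can be made injective.  The
   Schroeder-Bernstein bijection has bounded displacement and carries the
   Z^2-action over to pi_1(M).

   All metric estimates are made for cosh d - 1, written hgap and mgap, which is
   a rational function on H and satisfies a triangle inequality up to
   constants. *)

Import Order.TTheory GRing.Theory Num.Theory.
Import numFieldNormedType.Exports.
Set Implicit Arguments. Unset Strict Implicit. Unset Printing Implicit Defensive.
Local Open Scope classical_set_scope.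
Local Open Scope ring_scope.

(** * The hyperbolic cosine of the distance *)

Definition coshm1 {R : realType} (r : R) : R := (expR r + expR (- r)) / 2 - 1.

Section CoshMinusOne.
Context {R : realType}.
Implicit Types r s : R.

Lemma coshm1_ge0 r : 0 <= coshm1 r.
Proof.
rewrite /coshm1 expRN; have := expR_gt0 r; set e := expR r => e0.
suff : 0 <= (e - 1) ^+ 2 / e by rewrite (_ : _ / e = e + e^-1 - 2); [lra|field; lra].
by rewrite divr_ge0 ?sqr_ge0// ltW.
Qed.

Lemma coshm1_0 : coshm1 (0 : R) = 0.
Proof. by rewrite /coshm1 oppr0 expR0; lra. Qed.

Lemma ltr_coshm1 r s : 0 <= r -> 0 <= s -> (coshm1 r < coshm1 s) = (r < s).
Proof.
move=> r0 s0.
have H a b : 0 <= a -> a < b -> coshm1 a < coshm1 b.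
  move=> a0 ab; rewrite /coshm1 !expRN.
  have : expR a < expR b by rewrite ltr_expR.
  have : 1 <= expR a by rewrite -expR0 ler_expR.
  set x := expR a; set y := expR b => x1 xy.
  suff : 0 < (y - x) * (x * y - 1) / (x * y).
    rewrite (_ : _ / (x * y) = y + y^-1 - (x + x^-1)); first by lra.
    by field; apply/andP; split; rewrite gt_eqF//; lra.
  have xy1 : 1 < x * y by nra.
  by rewrite divr_gt0 ?mulr_gt0//; lra.
apply/idP/idP; last exact: H.
by apply: contraLR; rewrite -!leNgt le_eqVlt => /orP[/eqP->//|/H/ltW]; apply.
Qed.

Lemma coshm1_inj r s : 0 <= r -> 0 <= s -> coshm1 r = coshm1 s -> r = s.
Proof.
move=> r0 s0 e; apply/eqP; case: ltgtP => //.
- by rewrite -ltr_coshm1// e ltxx.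
- by rewrite -ltr_coshm1// e ltxx.
Qed.

Lemma coshm1_double r : coshm1 (2 * r) = 2 * coshm1 r * (coshm1 r + 2).
Proof.
rewrite /coshm1 -mulrN [2 * r]mulrC [2 * - r]mulrC !expRM_natr expRN.
have := expR_gt0 r; set e := expR r => e0; rewrite expr2; field; lra.
Qed.

(* AM-GM: [2 e^(r + s) <= e^(2 r) + e^(2 s)] *)
Lemma coshm1D r s :
  coshm1 (r + s) <= coshm1 r * (coshm1 r + 2) + coshm1 s * (coshm1 s + 2).
Proof.
suff : 2 * coshm1 (r + s) <= coshm1 (2 * r) + coshm1 (2 * s).
  by rewrite !coshm1_double; lra.
rewrite /coshm1 opprD -!mulrN [2 * r]mulrC [2 * s]mulrC [2 * - r]mulrC [2 * - s]mulrC.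
rewrite !expRM_natr !expRD.
by have := sqr_ge0 (expR r - expR s); have := sqr_ge0 (expR (- r) - expR (- s)); nra.
Qed.

Lemma arcosh_ge0 r : 1 <= r -> 0 <= arcosh r.
Proof.
move=> r1; rewrite /arcosh ln_ge0//.
by have := sqrtr_ge0 (r ^+ 2 - 1); lra.
Qed.

Lemma coshm1_arcosh r : 1 <= r -> coshm1 (arcosh r) = r - 1.
Proof.
move=> r1; rewrite /coshm1 /arcosh expRN lnK; last first.
  by rewrite posrE; have := sqrtr_ge0 (r ^+ 2 - 1); lra.
have s2 : Num.sqrt (r ^+ 2 - 1) ^+ 2 = r ^+ 2 - 1 by rewrite sqr_sqrtr//; nra.
set s := Num.sqrt _ in s2 *.
have s0 : 0 <= s by exact: sqrtr_ge0.
have -> : (r + s)^-1 = r - s by apply: (mulfI (x := r + s)); [lra|rewrite mulfV; [nra|lra]].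
by lra.
Qed.

Lemma lt_coshm1_ex (e : R) : 0 < e -> exists2 d, 0 < d & coshm1 d = e.
Proof.
move=> e0; exists (arcosh (1 + e)); last by rewrite coshm1_arcosh; lra.
rewrite lt_neqAle arcosh_ge0 ?andbT; last lra.
apply/eqP => h; have := @coshm1_arcosh (1 + e).
by rewrite -h coshm1_0; lra.
Qed.

End CoshMinusOne.

(* [cosh d - 1] for the distance [d] of the upper half-space *)
Definition hgap {R : realType} (p q : hyp3 R) : R :=
  ((hyp3_x p - hyp3_x q) ^+ 2 + (hyp3_y p - hyp3_y q) ^+ 2 +
   (hyp3_z p - hyp3_z q) ^+ 2) / (2 * hyp3_z p * hyp3_z q).

Section HalfSpaceGap.
Context {R : realType}.
Implicit Types p q r : hyp3 R.

Lemma hyp3_eq p q : hyp3_x p = hyp3_x q -> hyp3_y p = hyp3_y q ->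
  hyp3_z p = hyp3_z q -> p = q.
Proof.
case: p q => [x y z z0] [x' y' z' z0'] /= xx yy zz; subst.
by congr Hyp3; exact: bool_irrelevance.
Qed.

Lemma hgap_ge0 p q : 0 <= hgap p q.
Proof.
by rewrite /hgap divr_ge0 ?addr_ge0 ?sqr_ge0// !mulr_ge0// ltW// hyp3_z_gt0.
Qed.

Lemma hgap_sym p q : hgap p q = hgap q p.
Proof.
rewrite /hgap; congr (_ / _); first by ring.
by ring.
Qed.

Lemma hgap_eq p q d : (hgap p q = d) <->
  (hyp3_x p - hyp3_x q) ^+ 2 + (hyp3_y p - hyp3_y q) ^+ 2 +
   (hyp3_z p - hyp3_z q) ^+ 2 = d * (2 * hyp3_z p * hyp3_z q).
Proof.
have p0 := hyp3_z_gt0 p; have q0 := hyp3_z_gt0 q.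
have ? : 2 * hyp3_z p * hyp3_z q != 0 by rewrite gt_eqF// !mulr_gt0.
by rewrite /hgap; split => [<-|->]; rewrite ?divfK ?mulfK.
Qed.

Lemma hgap_le p q d : (hgap p q <= d) =
  ((hyp3_x p - hyp3_x q) ^+ 2 + (hyp3_y p - hyp3_y q) ^+ 2 +
   (hyp3_z p - hyp3_z q) ^+ 2 <= d * (2 * hyp3_z p * hyp3_z q)).
Proof.
have p0 := hyp3_z_gt0 p; have q0 := hyp3_z_gt0 q.
by rewrite /hgap ler_pdivrMr// !mulr_gt0.
Qed.

Lemma hgap_lt p q d : (hgap p q < d) =
  ((hyp3_x p - hyp3_x q) ^+ 2 + (hyp3_y p - hyp3_y q) ^+ 2 +
   (hyp3_z p - hyp3_z q) ^+ 2 < d * (2 * hyp3_z p * hyp3_z q)).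
Proof.
have p0 := hyp3_z_gt0 p; have q0 := hyp3_z_gt0 q.
by rewrite /hgap ltr_pdivrMr// !mulr_gt0.
Qed.

Lemma hgapxx p : hgap p p = 0.
Proof. by rewrite /hgap !subrr expr0n /= !addr0 mul0r. Qed.

Lemma hgap0 p q : hgap p q = 0 -> p = q.
Proof.
move/hgap_eq; rewrite mul0r => e.
have := sqr_ge0 (hyp3_x p - hyp3_x q); have := sqr_ge0 (hyp3_y p - hyp3_y q).
have := sqr_ge0 (hyp3_z p - hyp3_z q) => hz hy hx.
have zero (a b : R) : (a - b) ^+ 2 = 0 -> a = b.
  by move/eqP; rewrite sqrf_eq0 subr_eq0 => /eqP.
by apply: hyp3_eq; apply: zero; lra.
Qed.

(** The height term of the numerator alone gives [a ^+ 2 + b ^+ 2 <= 2 * (1 + g) * a * b] for the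
    heights [a] and [b]; drop [b ^+ 2] and divide by [a]. *)
Lemma hgap_height p q : hyp3_z p <= 2 * (1 + hgap p q) * hyp3_z q.
Proof.
have p0 := hyp3_z_gt0 p; have q0 := hyp3_z_gt0 q.
have /hgap_eq := erefl (hgap p q); set g := hgap p q.
have := sqr_ge0 (hyp3_x p - hyp3_x q); have := sqr_ge0 (hyp3_y p - hyp3_y q).
have g0 := hgap_ge0 p q; rewrite -/g in g0.
move: (hyp3_z p) (hyp3_z q) p0 q0 => a b a0 b0 hy hx e.
rewrite -(ler_pM2l a0) -subr_ge0.
have : (a - b) ^+ 2 <= g * (2 * a * b) by lra.
by rewrite !expr2; nra.
Qed.

(** The inequality [(u + v) ^+ 2 <= 2 * u ^+ 2 + 2 * v ^+ 2] bounds the numerator coordinatewise,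
    and [hgap_height] trades the height of [q] for that of [r] or [p]. *)
Lemma hgap_triangle q p r :
  hgap p r <= 4 * (hgap p q + hgap q r + 2 * hgap p q * hgap q r).
Proof.
have p0 := hyp3_z_gt0 p; have q0 := hyp3_z_gt0 q; have r0 := hyp3_z_gt0 r.
have h1 := hgap_height q r; have h2 := hgap_height q p; rewrite hgap_sym in h2.
have /hgap_eq := erefl (hgap p q); have /hgap_eq := erefl (hgap q r).
have a0 := hgap_ge0 p q; have b0 := hgap_ge0 q r.
move: (hgap p q) (hgap q r) a0 b0 h1 h2 => a b a0 b0 h1 h2 e2 e1.
rewrite hgap_le.
have := sqr_ge0 (hyp3_x p + hyp3_x r - 2 * hyp3_x q).
have := sqr_ge0 (hyp3_y p + hyp3_y r - 2 * hyp3_y q).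
have := sqr_ge0 (hyp3_z p + hyp3_z r - 2 * hyp3_z q).
move=> sz sy sx.
apply: (@le_trans _ _ (2 * (a * (2 * hyp3_z p * hyp3_z q)) +
                       2 * (b * (2 * hyp3_z q * hyp3_z r)))); first by lra.
move: (hyp3_z p) (hyp3_z q) (hyp3_z r) p0 q0 r0 h1 h2 {e1 e2 sz sy sx}.
move=> x y z x0 y0 z0 h1 h2.
have k1 : a * x * y <= a * x * (2 * (1 + b) * z).
  by rewrite ler_wpM2l// mulr_ge0// ltW.
have k2 : b * z * y <= b * z * (2 * (1 + a) * x).
  by rewrite ler_wpM2l// mulr_ge0// ltW.
by lra.
Qed.

(** The factor 16 is the loss per triangle inequality, from which the small scales [rho] and
    [lift_scale] are built. *)
Lemma hgap_triangle_small q p r (e : R) : e <= 2^-1 ->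
  hgap p q < e -> hgap q r < e -> hgap p r < 16 * e.
Proof.
move=> e1 a b; apply: le_lt_trans (hgap_triangle q p r) _.
have a0 := hgap_ge0 p q; have b0 := hgap_ge0 q r.
by move: (hgap p q) (hgap q r) a b a0 b0 => x y *; nra.
Qed.

Lemma coshm1_hyp3_dist p q : coshm1 (hyp3_dist p q) = hgap p q.
Proof.
rewrite /hyp3_dist -/(hgap p q) coshm1_arcosh; last by have := hgap_ge0 p q; lra.
by rewrite addrC addKr.
Qed.

Lemma hyp3_dist_ge0 p q : 0 <= hyp3_dist p q.
Proof. by apply: arcosh_ge0; have := hgap_ge0 p q; rewrite /hgap; lra. Qed.

End HalfSpaceGap.

(** * The same function of the distance on the manifold *)

Definition mgap {R : realType} {M : metricType R} (x y : M) : R :=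
  coshm1 (mdist x y).

Section MetricGap.
Context {R : realType} {M : metricType R}.
Implicit Types x y z : M.

Lemma mgap_ge0 x y : 0 <= mgap x y.
Proof. exact: coshm1_ge0. Qed.

Lemma mgapxx x : mgap x x = 0.
Proof. by rewrite /mgap mdistxx coshm1_0. Qed.

Lemma mgap_sym x y : mgap x y = mgap y x.
Proof. by rewrite /mgap metric_sym. Qed.

Lemma mgap0 x y : mgap x y = 0 -> x = y.
Proof.
rewrite -coshm1_0 => /coshm1_inj; rewrite mdist_ge0 lexx => /(_ isT isT).
exact: mdist_positivity.
Qed.

Lemma mgap_lt x y (d : R) : 0 <= d -> (mgap x y < coshm1 d) = (mdist x y < d).
Proof. by move=> d0; rewrite ltr_coshm1// mdist_ge0. Qed.

Lemma mgap_triangle y x z :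
  mgap x z <= mgap x y * (mgap x y + 2) + mgap y z * (mgap y z + 2).
Proof.
apply: le_trans (coshm1D _ _); rewrite leNgt ltr_coshm1 -?leNgt.
- exact: metric_triangle.
- by rewrite addr_ge0// mdist_ge0.
- exact: mdist_ge0.
Qed.

Lemma mgap_triangle_small y x z (e : R) : e <= 2^-1 ->
  mgap x y < e -> mgap y z < e -> mgap x z < 16 * e.
Proof.
move=> e1 a b; apply: le_lt_trans (mgap_triangle y x z) _.
have a0 := mgap_ge0 x y; have b0 := mgap_ge0 y z.
by move: (mgap x y) (mgap y z) a b a0 b0 => u v *; nra.
Qed.

Lemma nbhs_mgap x (e : R) : 0 < e -> nbhs x [set y | mgap x y < e].
Proof.
move=> e0; have [d d0 <-] := lt_coshm1_ex e0.
apply/nbhs_ballP; exists d => //=; rewrite ballEmdist => y /=.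
by rewrite mgap_lt// ltW.
Qed.

Lemma nbhs_mgapP x (A : set M) : nbhs x A ->
  exists2 e : R, 0 < e & forall y, mgap x y < e -> A y.
Proof.
move=> /nbhs_ballP[d /= d0 dA]; exists (coshm1 d).
  by rewrite -coshm1_0 ltr_coshm1// ltW.
by move=> y; rewrite mgap_lt ?ltW// => xy; apply: dA; rewrite ballEmdist.
Qed.

End MetricGap.

(** * Linear model and extension of isometries *)

Section LorentzModel.
Context {R : realType}.
Implicit Types (p q : hyp3 R) (v w : 'rV[R]_4) (A B P W : 'M[R]_4).

Let o1 : 'I_4 := lift ord0 ord0.
Let o2 : 'I_4 := lift ord0 (lift ord0 ord0).
Let o3 : 'I_4 := lift ord0 (lift ord0 (lift ord0 ord0)).

(* The image of [hyp3] is a sheet of the quadric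
   [v_0 v_3 - v_1 ^ 2 - v_2 ^ 2 = 1]; there isometries become linear. *)
Definition hvec p : 'rV[R]_4 := \row_(i < 4) nth 0
  [:: (hyp3_z p)^-1; hyp3_x p / hyp3_z p; hyp3_y p / hyp3_z p;
      (hyp3_x p ^+ 2 + hyp3_y p ^+ 2 + hyp3_z p ^+ 2) / hyp3_z p] i.

Definition lform_mx : 'M[R]_4 := \matrix_(i < 4, j < 4)
  nth 0 (nth [::] [:: [:: 0; 0; 0; 2^-1]; [:: 0; -1; 0; 0]; [:: 0; 0; -1; 0];
                      [:: 2^-1; 0; 0; 0]] i) j.

Definition lform v w : R := (v *m lform_mx *m w^T) 0 0.

Let lformE v w : lform v w =
  (v 0 ord0 * w 0 o3 + v 0 o3 * w 0 ord0) / 2 - v 0 o1 * w 0 o1 - v 0 o2 * w 0 o2.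
Proof.
rewrite /lform !mxE !big_ord_recl big_ord0 !mxE !big_ord_recl !big_ord0 !mxE /=.
by rewrite -/o1 -/o2 -/o3; ring.
Qed.

Definition hsheet v := lform v v = 1 /\ 0 < v 0 0.

Lemma lform_hvec p q : lform (hvec p) (hvec q) = 1 + hgap p q.
Proof.
have p0 := hyp3_z_gt0 p; have q0 := hyp3_z_gt0 q.
by rewrite lformE !mxE /= /hgap; field; rewrite !gt_eqF.
Qed.

Lemma hsheet_hvec p : hsheet (hvec p).
Proof.
split; first by rewrite lform_hvec hgapxx addr0.
by rewrite mxE /= invr_gt0 hyp3_z_gt0.
Qed.

Let row4P v w : v 0 ord0 = w 0 ord0 -> v 0 o1 = w 0 o1 -> v 0 o2 = w 0 o2 ->
  v 0 o3 = w 0 o3 -> v = w.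
Proof.
move=> e0 e1 e2 e3; apply/rowP => i.
case: (unliftP ord0 i) => [j ->|->//].
case: (unliftP ord0 j) => [k ->|->//].
case: (unliftP ord0 k) => [l ->|->//].
by rewrite [l]ord1.
Qed.

Lemma hsheetP v : hsheet v -> exists p, hvec p = v.
Proof.
move=> [vv v0]; rewrite lformE in vv.
have z0 : 0 < (v 0 ord0)^-1 by rewrite invr_gt0.
exists (Hyp3 (v 0 o1 / v 0 ord0) (v 0 o2 / v 0 ord0) z0).
have v0' : v 0 ord0 != 0 by rewrite gt_eqF.
apply: row4P; rewrite !mxE /= ?invrK ?divfK//.
apply: (mulfI v0'); rewrite (_ : v 0 ord0 * v 0 o3 = 1 + v 0 o1 ^+ 2 + v 0 o2 ^+ 2); last by lra.
by field.
Qed.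

Lemma hvec_inj : injective hvec.
Proof.
move=> p q pq; apply: hgap0.
have := lform_hvec p q; rewrite pq lform_hvec hgapxx addr0; lra.
Qed.

Lemma lform_gt0 v w : hsheet v -> hsheet w -> 0 < lform v w.
Proof.
move=> /hsheetP[p <-] /hsheetP[q <-]; rewrite lform_hvec.
by have := hgap_ge0 p q; lra.
Qed.

Let lformNl v w : lform (- v) w = - lform v w.
Proof. by rewrite !lformE !mxE; ring. Qed.

Let lformNN v : lform (- v) (- v) = lform v v.
Proof. by rewrite !lformE !mxE; ring. Qed.

(** The form is positive between points of one sheet, so its sign against [w] tells the sheet of
    [v]; [v 0 0 = 0] would force [lform v v <= 0]. *)
Lemma hsheet_pos v w : lform v v = 1 -> hsheet w -> 0 < lform v w -> hsheet v.
Proof.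
move=> vv hw vw; split=> //; rewrite lt_neqAle leNgt; apply/andP; split.
  apply/eqP => v0; move: vv; rewrite lformE -[v 0 ord0]v0.
  by have := sqr_ge0 (v 0 o1); have := sqr_ge0 (v 0 o2); rewrite !expr2; lra.
apply/negP => v0.
have hv : hsheet (- v) by split; rewrite ?lformNN// mxE oppr_gt0.
by have := lform_gt0 hv hw; rewrite lformNl; lra.
Qed.

Lemma lform_mx_unit : lform_mx \in unitmx.
Proof.
pose K : 'M[R]_4 := \matrix_(i < 4, j < 4)
  nth 0 (nth [::] [:: [:: 0; 0; 0; 2]; [:: 0; -1; 0; 0]; [:: 0; 0; -1; 0];
                      [:: 2; 0; 0; 0]] i) j.
suff /mulmx1_unit[] : lform_mx *m K = 1%:M by [].
apply/matrixP => i j; rewrite !mxE !big_ord_recl big_ord0 !mxE.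
by case: i => [[|[|[|[|i]]]] hi] //; case: j => [[|[|[|[|j]]]] hj] //=;
  rewrite -?val_eqE /=; lra.
Qed.

(** Row vectors are acted on from the right; the second clause excludes the maps that exchange the
    two sheets. *)
Definition lorentz B := B *m lform_mx *m B^T = lform_mx /\
  forall v, hsheet v -> hsheet (v *m B).

Lemma lorentz1 : lorentz 1%:M.
Proof. by split=> [|v hv]; rewrite ?mul1mx ?trmx1 ?mulmx1. Qed.

Lemma lorentzM A B : lorentz A -> lorentz B -> lorentz (A *m B).
Proof.
move=> [a a'] [b b']; split=> [|v hv]; last by rewrite mulmxA; exact/b'/a'.
by rewrite trmx_mul -!mulmxA (mulmxA B) (mulmxA (B *m _)) b mulmxA.
Qed.

Lemma lform_lorentz B v w : lorentz B -> lform (v *m B) (w *m B) = lform v w.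
Proof.
by move=> [bb _]; rewrite /lform trmx_mul -!mulmxA (mulmxA B) (mulmxA (B *m _)) bb.
Qed.

Lemma lorentz_unit B : lorentz B -> B \in unitmx.
Proof.
move=> [bb _].
suff /mulmx1_unit[] : B *m (lform_mx *m B^T *m invmx lform_mx) = 1%:M by [].
by rewrite !mulmxA bb mulmxV// lform_mx_unit.
Qed.

Lemma lorentz_surj B q : lorentz B -> exists p, hvec p *m B = hvec q.
Proof.
move=> lB; have uB := lorentz_unit lB.
suff /hsheetP[p pE] : hsheet (hvec q *m invmx B) by exists p; rewrite pE mulmxKV.
have [hq h0] := (hsheet_hvec q, lB.2 _ (hsheet_hvec q)).
apply: (hsheet_pos _ (hsheet_hvec q)); rewrite -(lform_lorentz _ _ lB) mulmxKV//.
  by case: hq.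
exact: lform_gt0.
Qed.

Let trans (p : hyp3 R) (h : R) (h0 : 0 <= h) (i : 'I_4) : hyp3 R :=
  Hyp3 (hyp3_x p + h *+ (i == o1)) (hyp3_y p + h *+ (i == o2))
    (ltr_wpDr (mulrn_wge0 (i == o3) h0) (hyp3_z_gt0 p)).

(** An isometry is determined by its values at four such points, and they fit in any ball. They are
    [p] and its shifts by [h] along the three axes; the index [ord0] gives no shift. *)
Lemma hvec_basis p (d : R) : 0 < d -> exists q : 'I_4 -> hyp3 R,
  (forall i, hgap p (q i) < d) /\ \matrix_(i < 4) hvec (q i) \in unitmx.
Proof.
move=> d0; have z0 := hyp3_z_gt0 p.
pose h := Num.min 1 (d * hyp3_z p ^+ 2).
have h1 : h <= 1 by rewrite ge_min lexx.
have h2 : h <= d * hyp3_z p ^+ 2 by rewrite ge_min lexx orbT.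
have h0 : 0 < h by rewrite lt_min ltr01 mulr_gt0// exprn_gt0.
exists (trans p (ltW h0)); split.
  move=> i; rewrite hgap_lt /trans /=.
  have e0 : 0 <= h *+ (i == o3) by rewrite mulrn_wge0// ltW.
  apply: (@le_lt_trans _ _ (h ^+ 2)).
    rewrite !opprD !addNKr !sqrrN.
    case: (i =P o1) => [->|_] /=; first by rewrite !mulr0n; lra.
    case: (i =P o2) => [->|_] /=; first by rewrite !mulr0n; lra.
    by case: (i == o3); rewrite ?mulr0n ?mulr1n; [lra|nra].
  apply: (@lt_le_trans _ _ (d * (2 * hyp3_z p * hyp3_z p))).
    have : h ^+ 2 <= h by rewrite expr2 ler_piMl// ltW.
    have : 0 < d * hyp3_z p ^+ 2 by rewrite mulr_gt0// exprn_gt0.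
    lra.
  apply: ler_wpM2l; first exact: ltW.
  by apply: ler_wpM2l; rewrite ?lerDl// mulr_ge0// ltW.
(* A linear relation [v] is a polynomial [v_0 + v_1 x + v_2 y + v_3 (x^2 + y^2 + z^2)] vanishing at
   the four points; comparing the shifted points with [p] kills its coefficients. *)
rewrite -unitmx_tr -row_free_unit; apply: inj_row_free => v /rowP v0.
have eqn i : v 0 ord0 + v 0 o1 * hyp3_x (trans p (ltW h0) i) +
   v 0 o2 * hyp3_y (trans p (ltW h0) i) + v 0 o3 * (hyp3_x (trans p (ltW h0) i) ^+ 2 +
     hyp3_y (trans p (ltW h0) i) ^+ 2 + hyp3_z (trans p (ltW h0) i) ^+ 2) = 0.
  have := v0 i; rewrite !mxE !big_ord_recl big_ord0 !mxE.
  move: (trans p (ltW h0) i) => t /=; rewrite -/o1 -/o2 -/o3.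
  move: (hyp3_x t) (hyp3_y t) (hyp3_z t) (hyp3_z_gt0 t) => x y z zz.
  move=> e; have /(congr1 (fun t => t * z)) := e; rewrite mul0r => <-; field.
  by rewrite gt_eqF.
have := eqn ord0; have := eqn o1; have := eqn o2; have := eqn o3; rewrite /trans /=.
rewrite !mulr0n !mulr1n !addr0.
move: (hyp3_x p) (hyp3_y p) (hyp3_z p) z0 => x y z z0.
move=> e3 e2 e1 e0.
have cancel (c k : R) : 0 < k -> c * k = 0 -> c = 0.
  by move=> k0 /eqP; rewrite mulf_eq0 (gt_eqF k0) orbF => /eqP.
have f3 : v 0 o3 = 0.
  by apply: (@cancel _ (h * (2 * z + h))); [rewrite mulr_gt0 ?addr_gt0 ?mulr_gt0|lra].
have f1 : v 0 o1 = 0 by apply: (@cancel _ h) => //; move: e1 e0; rewrite f3; lra.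
have f2 : v 0 o2 = 0 by apply: (@cancel _ h) => //; move: e2 e0; rewrite f3; lra.
have f0 : v 0 ord0 = 0 by move: e0; rewrite f1 f2 f3; lra.
by apply: row4P; rewrite mxE.
Qed.

Let lform_row P v i : (v *m lform_mx *m P^T) 0 i = lform v (row i P).
Proof.
by rewrite /lform !mxE; apply: eq_bigr => j _; rewrite !mxE.
Qed.

(** Both quadruples have the same Gram matrix, so the linear map [invmx P *m W] between them
    preserves the form. A vector is determined by its products with a basis, so this map sends each
    point to the one with the same gaps. *)
Lemma lorentz_ext (q q' : 'I_4 -> hyp3 R) :
  (forall i j, hgap (q i) (q j) = hgap (q' i) (q' j)) ->
  \matrix_(i < 4) hvec (q i) \in unitmx ->
  exists2 T, lorentz T & forall p p', (forall i, hgap p (q i) = hgap p' (q' i)) ->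
    hvec p *m T = hvec p'.
Proof.
move=> qq' uP; set P := (\matrix_i hvec (q i)) in uP.
pose W := \matrix_(i < 4) hvec (q' i).
have PW v w : (forall i, lform v (hvec (q i)) = lform w (hvec (q' i))) ->
    v *m lform_mx *m P^T = w *m lform_mx *m W^T.
  by move=> vw; apply/rowP => i; rewrite !lform_row !rowK.
have PPWW : P *m lform_mx *m P^T = W *m lform_mx *m W^T.
  apply/row_matrixP => i; rewrite !row_mul !rowK; apply: PW => j.
  by rewrite !lform_hvec qq'.
have [T PT TT] : exists2 T, P *m T = W & T *m lform_mx *m T^T = lform_mx.
  exists (invmx P *m W); first by rewrite mulKVmx.
  rewrite trmx_mul -!mulmxA (mulmxA W) (mulmxA (W *m _)) -PPWW.
  by rewrite trmx_inv !mulmxA mulVmx// mul1mx -mulmxA mulmxV ?mulmx1// unitmx_tr.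
have lT v w : lform (v *m T) (w *m T) = lform v w.
  by rewrite /lform trmx_mul -!mulmxA (mulmxA T) (mulmxA (T *m _)) TT.
exists T.
  split=> // v hv; apply: (hsheet_pos (w := hvec (q' 0))).
  - by rewrite lT; case: hv.
  - exact: hsheet_hvec.
  - have -> : hvec (q' 0) = hvec (q 0) *m T.
      by rewrite -(rowK (fun i => hvec (q' i))) -/W -PT row_mul rowK.
    by rewrite lT; apply: lform_gt0 => //; exact: hsheet_hvec.
move=> p p' pp'.
have : hvec p *m lform_mx *m P^T = hvec p' *m lform_mx *m W^T.
  by apply: PW => i; rewrite !lform_hvec pp'.
have uPT : P^T \in unitmx by rewrite unitmx_tr.
rewrite -PT trmx_mul mulmxA => /(can_inj (mulmxK uPT)) e.
have uT : T \in unitmx.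
  suff /mulmx1_unit[] : T *m (lform_mx *m T^T *m invmx lform_mx) = 1%:M by [].
  by rewrite !mulmxA TT mulmxV// lform_mx_unit.
have uTT : T^T \in unitmx by rewrite unitmx_tr.
apply: (can_inj (mulmxK lform_mx_unit)); apply: (can_inj (mulmxK uTT)).
by rewrite -e -2!mulmxA [T *m _]mulmxA TT.
Qed.

Lemma lorentz_eq (q : 'I_4 -> hyp3 R) A B :
  \matrix_(i < 4) hvec (q i) \in unitmx ->
  (forall i, hvec (q i) *m A = hvec (q i) *m B) -> A = B.
Proof.
move=> uP AB; apply: (can_inj (mulKmx uP)).
by apply/row_matrixP => i; rewrite !row_mul !rowK.
Qed.

End LorentzModel.

(** * Developing the half-space *)

(* A discrete form of the monodromy theorem.  [flat e e'] says that [e'] is the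
   parallel transport of [e] to the nearby fibre over [pr e']; the base [D] is
   contracted to [pr e0] along the segments [mix ^~ (pr e0) d]. *)
Section FlatSection.
Context {R : realType} {D E : Type} {near Near : D -> D -> Prop}
  {mix : R -> D -> D -> D} {ok : E -> Prop} {pr : E -> D}
  {flat : E -> E -> Prop} {e0 : E}.
Context (ok0 : ok e0)
  (nearxx : forall d, near d d)
  (near2 : forall a b c, near a b -> near b c -> Near a c)
  (mix0 : forall d, mix 0 (pr e0) d = pr e0)
  (mix1 : forall d, mix 1 (pr e0) d = d)
  (mixx : forall t, mix t (pr e0) (pr e0) = pr e0)
  (near_mix : forall t d d', 0 <= t -> t <= 1 -> near d d' ->
    near (mix t (pr e0) d) (mix t (pr e0) d'))
  (near_steps : forall d, exists N0 : nat, forall N k : nat, (N0 <= N)%N ->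
    (k < N)%N -> near (mix (k%:R / N%:R) (pr e0) d) (mix (k.+1%:R / N%:R) (pr e0) d))
  (flat_refl : forall e, ok e -> flat e e)
  (flat_sym : forall e e', ok e -> ok e' -> flat e e' -> flat e' e)
  (transport : forall e d, ok e -> near (pr e) d ->
    exists e', [/\ ok e', pr e' = d & flat e e'])
  (flat_eq : forall e e', ok e -> ok e' -> flat e e' -> pr e = pr e' -> e = e')
  (flat_trans : forall e e' e'', ok e -> ok e' -> ok e'' -> flat e e' ->
    flat e' e'' -> Near (pr e) (pr e'') -> flat e e'').

Let along (N : nat) (d : D) (e : E) := exists a : nat -> E,
  [/\ a 0%N = e0, a N = e,
      forall k, (k <= N)%N -> ok (a k) /\ pr (a k) = mix (k%:R / N%:R) (pr e0) d &
      forall k, (k < N)%N -> flat (a k) (a k.+1)].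

Let fine (N : nat) (d : D) := forall k, (k < N)%N ->
  near (mix (k%:R / N%:R) (pr e0) d) (mix (k.+1%:R / N%:R) (pr e0) d).

Let alongP N d e : (0 < N)%N -> along N d e -> ok e /\ pr e = d.
Proof.
move=> N0 [a [_ <- /(_ N (leqnn N))[ok_ ->] _]]; split=> //.
by rewrite divff ?mix1// pnatr_eq0 -lt0n.
Qed.

Let along_ex N d : fine N d -> exists e, along N d e.
Proof.
move=> fN.
have /choice[tr trP] : forall ed : E * D, exists e', ok ed.1 -> near (pr ed.1) ed.2 ->
    [/\ ok e', pr e' = ed.2 & flat ed.1 e'].
  move=> [e d'] /=; have [[oe nd]|h] := pselect (ok e /\ near (pr e) d').
    by have [e' ?] := transport oe nd; exists e'.
  by exists e => ? ?; exfalso; exact: h.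
pose a := fix a (k : nat) : E :=
  if k is k'.+1 then tr (a k', mix (k%:R / N%:R) (pr e0) d) else e0.
have aP k : (k <= N)%N -> ok (a k) /\ pr (a k) = mix (k%:R / N%:R) (pr e0) d.
  elim: k => [_|k IHk kN]; first by rewrite mul0r mix0.
  have [oa pa] := IHk (ltnW kN).
  have := trP (a k, mix (k.+1%:R / N%:R) (pr e0) d) oa.
  by rewrite /= pa => /(_ (fN _ kN))[].
exists (a N), a; split => // k kN.
have [oa pa] := aP k (ltnW kN).
have := trP (a k, mix (k.+1%:R / N%:R) (pr e0) d) oa.
by rewrite /= pa => /(_ (fN _ kN))[].
Qed.

Let near_Near d d' : near d d' -> Near d d'.
Proof. exact: near2 (nearxx _). Qed.

(** Two neighbouring chains are compared rung by rung: the diagonal from [a k] to [a' k.+1] cuts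
    each quadrilateral into two triangles small enough for [flat_trans]. *)
Let ladder N d d' e e' : (0 < N)%N -> fine N d -> fine N d' -> near d d' ->
  along N d e -> along N d' e' -> flat e e'.
Proof.
move=> N0 fd fd' dd' [a [a0 <- aP aF]] [a' [a0' <- aP' aF']].
have h k : (k <= N)%N -> near (pr (a k)) (pr (a' k)).
  move=> kN; have [_ ->] := aP _ kN; have [_ ->] := aP' _ kN.
  apply: near_mix dd'; first by rewrite divr_ge0.
  by rewrite ler_pdivrMr ?ltr0n// mul1r ler_nat.
have step k : (k < N)%N -> near (pr (a' k)) (pr (a' k.+1)).
  move=> kN; have [_ ->] := aP' _ (ltnW kN); have [_ ->] := aP' _ kN.
  exact: fd'.
suff H k : (k <= N)%N -> flat (a k) (a' k) by exact: H.
elim: k => [_|k IHk kN]; first by rewrite a0 a0'; exact: flat_refl.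
have [o1 _] := aP _ (ltnW kN); have [o2 _] := aP' _ (ltnW kN).
have [o3 _] := aP _ kN; have [o4 _] := aP' _ kN.
have f1 : flat (a k) (a' k.+1).
  apply: (flat_trans o1 o2 o4); [exact/IHk/ltnW|exact: aF'|].
  by apply: near2 (step _ kN); exact/h/ltnW.
apply: (flat_trans o3 o1 o4) => //; first by apply: flat_sym => //; exact: aF.
exact/near_Near/h.
Qed.

(** Ends of chains of any shape issuing from [e0]. Simple connectedness of [D] takes the form of
    uniqueness of the end over each point. *)
Inductive reachable : E -> Prop :=
| reachable0 : reachable e0
| reachableS e e' : reachable e -> ok e' -> flat e e' -> near (pr e) (pr e') ->
    reachable e'.

Let reachable_ok e : reachable e -> ok e.
Proof. by case. Qed.

Let fine_ex d : exists N0 : nat, forall N, (N0 <= N)%N -> fine N d.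
Proof. by have [N0 H] := near_steps d; exists N0 => N NN k; exact: H. Qed.

(* Fan triangulation: a chain issuing from [e0] has the same transport as the
   segment from its origin to its end. *)
Let reachable_along e : reachable e ->
  exists N0 : nat, forall N, (N0 < N)%N -> fine N (pr e) /\ along N (pr e) e.
Proof.
elim=> [|{}e e' re [N0 N0P] oe' ee' nee'].
  have [N0 fN] := fine_ex (pr e0).
  exists N0 => N NN; split; first exact/fN/ltnW.
  by exists (fun=> e0); split => // k _; exact: flat_refl.
have [N1 N1P] := fine_ex (pr e').
exists (maxn N0 N1) => N; rewrite gtn_max => /andP[N0N N1N].
have [fe ae] := N0P _ N0N; have fe' := N1P _ (ltnW N1N); split => //.
have [b ab] := along_ex fe'.
have NN : (0 < N)%N by case: N N0N {N1N fe ae fe' ab}.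
have [ob pb] := alongP NN ab.
have eb : flat e b by exact: ladder nee' ae ab.
have oe := reachable_ok re.
suff e'b : e' = b by rewrite {2}e'b.
apply: flat_eq; rewrite ?pb//.
by apply: (flat_trans oe' oe ob) => //; [exact: flat_sym|rewrite pb; exact: near_Near].
Qed.

Lemma flat_section : exists s : D -> E, [/\ s (pr e0) = e0,
  forall d, ok (s d) /\ pr (s d) = d & forall d d', near d d' -> flat (s d) (s d')].
Proof.
have uniq e e' : reachable e -> reachable e' -> pr e = pr e' -> e = e'.
  move=> re re' ee'.
  have [N0 N0P] := reachable_along re; have [N1 N1P] := reachable_along re'.
  have [fe ae] := N0P (maxn N0 N1).+1 (leq_maxl _ _).
  have [fe' ae'] := N1P (maxn N0 N1).+1 (leq_maxr _ _).
  apply: flat_eq => //; try exact: reachable_ok.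
  by apply: (ladder (ltn0Sn _) fe fe') => //; rewrite ee'.
have ex d : exists e, reachable e /\ pr e = d.
  have [N0 N0P] := fine_ex d; have fN := N0P N0.+1 (leqnSn _).
  have [e ae] := along_ex fN; have [oe pe] := alongP (ltn0Sn _) ae.
  exists e; split=> //; case: ae => a [a0 <- aP aF].
  elim: {-2}N0.+1 (leqnn N0.+1) => [_|k IHk kN]; first by rewrite a0; exact: reachable0.
  have [_ pk] := aP _ (ltnW kN); have [ok1 pk1] := aP _ kN.
  apply: reachableS (IHk (ltnW kN)) _ (aF _ kN) _ => //.
  by rewrite pk pk1; exact: fN.
have [s sP] := choice ex.
exists s; split.
- by have [rs ps] := sP (pr e0); apply: uniq => //; exact: reachable0.
- by move=> d; have [/reachable_ok ? ?] := sP d.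
(* The transport of [s d] to [d'] is reachable too, so by uniqueness it is [s d']. *)
- move=> d d' dd'; have [rs ps] := sP d; have [rs' ps'] := sP d'.
  have nd : near (pr (s d)) d' by rewrite ps.
  have [e' [oe' pe' fe']] := transport (reachable_ok rs) nd.
  suff -> : s d' = e' by [].
  apply: uniq; rewrite ?pe'//; apply: reachableS rs oe' fe' _.
  by rewrite pe' ps.
Qed.

End FlatSection.

(** * Charts of a uniform size *)

Section UniformCharts.
Context {R : realType} {M : metricType R}.

Definition chart_at (e : R) (x : M) (f : M -> hyp3 R) : Prop :=
  (forall y z, mgap x y < e -> mgap x z < e -> hgap (f y) (f z) = mgap y z) /\
  (forall q, hgap (f x) q < e -> exists2 y, mgap x y < e & f y = q).

(** One chart at [x] serves all nearby centres and all smaller radii by the triangle inequality;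
    compactness needs this local uniformity. *)
Lemma chart_at_ex (x : M) : locally_hyp3 M -> exists2 e : R, 0 < e &
  forall x' d, mgap x x' < e -> 0 < d < e -> exists f, chart_at d x' f.
Proof.
move=> /(_ x)[r [f [r0 fiso fonto]]].
have c0 : 0 < coshm1 r by rewrite -coshm1_0 ltr_coshm1// ltW.
have r0' := ltW r0.
pose e := Num.min (coshm1 r) 2^-1 / 16.
have e0 : 0 < e by rewrite divr_gt0// lt_min c0 invr_gt0 ltr0n.
have e12 : e <= 2^-1.
  have : Num.min (coshm1 r) 2^-1 <= 2^-1 by rewrite ge_min lexx orbT.
  by rewrite /e; lra.
have e16 : 16 * e <= coshm1 r.
  have : Num.min (coshm1 r) 2^-1 <= coshm1 r by rewrite ge_min lexx.
  by rewrite /e; lra.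
have inball y : mgap x y < coshm1 r -> ball x r y by rewrite mgap_lt// ballEmdist.
have fgap y z : ball x r y -> ball x r z -> hgap (f y) (f z) = mgap y z.
  by move=> xy xz; rewrite -coshm1_hyp3_dist fiso.
exists e => // x' d xx' /andP[d0 de]; exists f.
have near_ball y : mgap x' y < d -> ball x r y.
  move=> x'y; apply: inball; apply: lt_le_trans e16.
  by apply: (@mgap_triangle_small _ _ x') => //; exact: lt_trans de.
have bx' : ball x r x' by apply: near_ball; rewrite mgapxx.
have bx : ball x r x by exact: ballxx.
split=> [y z /near_ball yb /near_ball zb|q qd]; first exact: fgap.
have : [set q | hyp3_dist (f x) q < r] q.
  rewrite /= -ltr_coshm1 ?hyp3_dist_ge0// coshm1_hyp3_dist.
  apply: lt_le_trans e16; apply: (@hgap_triangle_small _ (f x')) => //.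
    by rewrite fgap.
  exact: lt_trans de.
rewrite -fonto => -[y yb yq]; exists y => //.
by rewrite -fgap// yq.
Qed.

Lemma uniform_charts : compact [set: M] -> locally_hyp3 M ->
  exists e : R, [/\ 0 < e, e <= 2^-1 &
    exists F : M -> M -> hyp3 R, forall x, chart_at e x (F x)].
Proof.
move=> cM lM.
(* Compactness in its near-covering form, with the radius as parameter, gives one radius for all
   centres. *)
have : \forall d \near (0 : R)^'+, forall x : M, [set: M] x -> exists f, chart_at d x f.
  move/compact_near_coveringP : cM; apply => x _.
  have [e e0 eP] := chart_at_ex x lM.
  exists ([set x' | mgap x x' < e], [set d | 0 < d < e]).
    split; first exact: nbhs_mgap.
    near=> d; apply/andP; split; near: d; [exact: nbhs_right_gt|exact: nbhs_right_lt].
  by move=> [x' d] /= [? ?]; exact: eP.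
move=> dP; have : \forall d \near (0 : R)^'+, [/\ 0 < d, d < 2^-1 &
    forall x : M, [set: M] x -> exists f, chart_at d x f].
  near=> d; split; near: d => //; [exact: nbhs_right_gt|].
  by apply: nbhs_right_lt; rewrite invr_gt0.
move=> /filter_ex[d [d0 d1 dF]]; exists d; split=> //; first exact: ltW.
have /choice[F FP] : forall x, exists f, chart_at d x f by move=> x; exact: dF.
by exists F.
Unshelve. all: by end_near. Qed.

End UniformCharts.

(** * Contraction of the half-space along Euclidean segments *)

Section HalfSpaceMix.
Context {R : realType}.
Implicit Types (p q : hyp3 R) (t : R).

Lemma hmix_proof t p q :
  0 < (1 - clamp t) * hyp3_z p + clamp t * hyp3_z q.
Proof.
have := clampP t; rewrite in_itv /= => /andP[t0 t1].
have := hyp3_z_gt0 p; have := hyp3_z_gt0 q.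
by move: (hyp3_z p) (hyp3_z q) => a b; have [->|] := eqVneq (clamp t) 0; [lra|nra].
Qed.

(* Euclidean segments of the half-space; they are not geodesics, but the
   contractions they define do not increase the hyperbolic distance. *)
Definition hmix t p q : hyp3 R :=
  Hyp3 ((1 - clamp t) * hyp3_x p + clamp t * hyp3_x q)
       ((1 - clamp t) * hyp3_y p + clamp t * hyp3_y q) (hmix_proof t p q).

Lemma hmix0 p q : hmix 0 p q = p.
Proof. by apply: hyp3_eq; rewrite /= clamp_le0//; ring. Qed.

Lemma hmix1 p q : hmix 1 p q = q.
Proof. by apply: hyp3_eq; rewrite /= clamp_ge1//; ring. Qed.

Lemma hmixxx t p : hmix t p p = p.
Proof. by apply: hyp3_eq; rewrite /=; ring. Qed.

(** The numerator is scaled by [s ^+ 2], where [s] is [clamp t], while each new height is at least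
    [s] times the old one. *)
Lemma hgap_hmix t p q q' : hgap (hmix t p q) (hmix t p q') <= hgap q q'.
Proof.
rewrite hgap_le /=; have /hgap_eq := erefl (hgap q q').
have g0 := hgap_ge0 q q'; have := clampP t; rewrite in_itv /= => /andP[t0 t1].
have p0 := hyp3_z_gt0 p; have q0 := hyp3_z_gt0 q; have q0' := hyp3_z_gt0 q'.
move: (clamp t) t0 t1 => s s0 s1 e.
apply: (@le_trans _ _ (s ^+ 2 * (hgap q q' * (2 * hyp3_z q * hyp3_z q')))).
  by rewrite -e; rewrite le_eqVlt; apply/orP; left; apply/eqP; ring.
rewrite mulrCA ler_wpM2l//.
rewrite -![2 * _ * _]mulrA mulrCA ler_wpM2l// expr2 mulrACA.
have a0 := mulr_ge0 s0 (ltW q0); have a0' := mulr_ge0 s0 (ltW q0').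
by apply: ler_pM => //; rewrite lerDr mulr_ge0 ?subr_ge0// ltW.
Qed.

(** Every height on the segment is at least the lower of the two end heights, and [hgap_height]
    compares the square of the latter with their product. *)
Lemma hgap_hmix2 s t p q : hgap (hmix s p q) (hmix t p q) <=
  (clamp s - clamp t) ^+ 2 * (2 * (1 + hgap p q) * hgap p q).
Proof.
rewrite hgap_le /=; have /hgap_eq := erefl (hgap p q).
have h1 := hgap_height p q; have h2 := hgap_height q p; rewrite hgap_sym in h2.
have g0 := hgap_ge0 p q.
have := clampP s; rewrite in_itv /= => /andP[s0 s1].
have := clampP t; rewrite in_itv /= => /andP[t0 t1].
have p0 := hyp3_z_gt0 p; have q0 := hyp3_z_gt0 q.
move: (clamp s) (clamp t) s0 s1 t0 t1 => {}s {}t s0 s1 t0 t1 e.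
apply: (@le_trans _ _ ((s - t) ^+ 2 * (hgap p q * (2 * hyp3_z p * hyp3_z q)))).
  by rewrite -e le_eqVlt; apply/orP; left; apply/eqP; ring.
rewrite -[leRHS]mulrA ler_wpM2l ?sqr_ge0//.
move: (hgap p q) (hyp3_z p) (hyp3_z q) p0 q0 g0 h1 h2 {e} => g a b a0 b0 g0 h1 h2.
set u := (1 - s) * a + s * b; set v := (1 - t) * a + t * b.
suff : a * b <= 2 * (1 + g) * (u * v).
  by move=> /(ler_wpM2l g0); lra.
have [ab|/ltW ba] := leP a b.
  have au : a <= u by rewrite /u -subr_ge0 (_ : _ - a = s * (b - a)) ?mulr_ge0//; [lra|ring].
  have av : a <= v by rewrite /v -subr_ge0 (_ : _ - a = t * (b - a)) ?mulr_ge0//; [lra|ring].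
  apply: (@le_trans _ _ (2 * (1 + g) * (a * a))); first by nra.
  by rewrite ler_wpM2l ?mulr_ge0//; [lra|apply: ler_pM => //; exact: ltW].
have bu : b <= u.
  rewrite /u -subr_ge0 (_ : _ - b = (1 - s) * (a - b)); last by ring.
  by rewrite mulr_ge0 ?subr_ge0.
have bv : b <= v.
  rewrite /v -subr_ge0 (_ : _ - b = (1 - t) * (a - b)); last by ring.
  by rewrite mulr_ge0 ?subr_ge0.
apply: (@le_trans _ _ (2 * (1 + g) * (b * b))); first by nra.
by rewrite ler_wpM2l ?mulr_ge0//; [lra|apply: ler_pM => //; exact: ltW].
Qed.

Lemma clamp_lip s t : `|clamp s - clamp t| <= `|s - t|.
Proof.
wlog st : s t / s <= t.
  by move=> H; case/orP: (le_total s t) => /H//; rewrite distrC [`|t - s|]distrC.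
have [s0|s0] := leP s 0; have [t0|t0] := leP t 0.
- by rewrite !clamp_le0// subrr normr0.
- rewrite (clamp_le0 s0) sub0r normrN [leRHS]ler0_norm ?subr_le0// opprB.
  have [t1|t1] := leP 1 t; first by rewrite clamp_ge1// normr1; lra.
  rewrite clampE; last by rewrite in_itv /=; apply/andP; split; lra.
  by rewrite ger0_norm; lra.
- lra.
have [s1|s1] := leP 1 s.
  by rewrite !clamp_ge1 ?subrr ?normr0//; exact: le_trans st.
rewrite [clamp s]clampE; last by rewrite in_itv /=; apply/andP; split; lra.
rewrite [leRHS]ler0_norm ?subr_le0// opprB.
have [t1|t1] := leP 1 t; first by rewrite clamp_ge1// ler0_norm; lra.
rewrite clampE; last by rewrite in_itv /=; apply/andP; split; lra.
by rewrite ler0_norm; lra.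
Qed.

(** The number of steps depends only on a bound for the gap of the ends; the bound on word lengths
    rests on this uniformity. *)
Lemma hmix_steps (r e : R) : 0 < e -> exists N0 : nat, forall N : nat,
  (N0 <= N)%N -> forall p q s t, hgap p q <= r -> `|s - t| <= N%:R^-1 ->
  hgap (hmix s p q) (hmix t p q) < e.
Proof.
move=> e0; pose C := 2 * (1 + r) * r / e.
exists (Num.truncn C).+1 => N NN p q s t gr st.
have g0 := hgap_ge0 p q.
have CN : C < N%:R.
  by apply: lt_le_trans (truncnS_gt _) _; rewrite ler_nat.
have N1 : 1 <= N%:R :> R by rewrite ler1n (leq_trans _ NN).
have N0 : 0 < N%:R :> R by lra.
apply: le_lt_trans (hgap_hmix2 _ _ _ _) _.
(* One factor [N%:R^-1] of the square suffices; the other is bounded by 1. *)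
have d1 : (clamp s - clamp t) ^+ 2 <= N%:R^-1.
  have dN := le_trans (clamp_lip s t) st.
  rewrite -real_normK ?num_real// expr2; apply: (@le_trans _ _ (N%:R^-1 * 1)); last by lra.
  by apply: ler_pM => //; apply: le_trans dN _; rewrite invf_le1.
apply: (@le_lt_trans _ _ (N%:R^-1 * (2 * (1 + r) * r))).
  by apply: ler_pM; rewrite ?sqr_ge0//; nra.
by rewrite mulrC ltr_pdivrMr// [e * _]mulrC -ltr_pdivrMr.
Qed.

End HalfSpaceMix.

(** * Continuation of germs of local isometries *)

Section Developing.
Context {R : realType} {M : metricType R} {e : R} {F : M -> M -> hyp3 R}.
Context (e0 : 0 < e) (e12 : e <= 2^-1) (FP : forall x, chart_at e x (F x)).

(** Two factors 16 leave room for two triangle inequalities inside a chart of radius [e]. *)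
Let rho : R := e / 16 / 16.

Let rho0 : 0 < rho. Proof. by rewrite !divr_gt0. Qed.

(* [(x, B, q)] is the germ at [x] of the local isometry [y |-> F x y B] onto a
   neighbourhood of [q]. *)
Let germ : Type := (M * 'M[R]_4 * hyp3 R)%type.

Let ok (g : germ) := lorentz g.1.2 /\ hvec (F g.1.1 g.1.1) *m g.1.2 = hvec g.2.

Let flat (g g' : germ) := mgap g.1.1 g'.1.1 < rho /\
  forall y, mgap g.1.1 y < e -> mgap g'.1.1 y < e ->
    hvec (F g.1.1 y) *m g.1.2 = hvec (F g'.1.1 y) *m g'.1.2.

Let self (x : M) : mgap x x < e. Proof. by rewrite mgapxx. Qed.

Let mgap_rho1 (x y z : M) : mgap x y < rho -> mgap y z < rho -> mgap x z < 16 * rho.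
Proof. by apply: mgap_triangle_small; have := e0; have := e12; rewrite /rho; lra. Qed.

Let mgap_rho2 (x y z : M) : mgap x y < 16 * rho -> mgap y z < 16 * rho -> mgap x z < e.
Proof.
have := e0; have := e12 => ? ?.
move=> xy yz; rewrite (_ : e = 16 * (16 * rho)); last by rewrite /rho; lra.
by apply: (@mgap_triangle_small _ _ y) => //; rewrite /rho; lra.
Qed.

Let rho16 r : r < rho -> r < 16 * rho.
Proof. by have := rho0; lra. Qed.

Let rho_e r : r < 16 * rho -> r < e.
Proof. by rewrite /rho; have := e0; lra. Qed.

Let chart_basis x : exists y : 'I_4 -> M, (forall i, mgap x (y i) < rho) /\
  \matrix_(i < 4) hvec (F x (y i)) \in unitmx.
Proof.
have [iso onto] := FP x; have [q [qx uq]] := hvec_basis (F x x) rho0.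
have /choice[y yP] : forall i, exists y, mgap x y < rho /\ F x y = q i.
  move=> i; have [y xy yq] := onto (q i) (rho_e (rho16 (qx i))).
  by exists y; split=> //; rewrite -(iso _ _ (self x) xy) yq.
exists y; split=> [i|]; first by have [] := yP i.
rewrite (_ : (\matrix_i _) = \matrix_i hvec (q i))//.
by apply/row_matrixP => i; rewrite !rowK; have [_ ->] := yP i.
Qed.

(** A basis close to [x'] lies in both charts, and the chart change preserves gaps, so [lorentz_ext]
    applies. *)
Let transition x x' : mgap x x' < 16 * rho -> exists2 T, lorentz T &
  forall y, mgap x y < e -> mgap x' y < e -> hvec (F x' y) *m T = hvec (F x y).
Proof.
move=> xx'; have [y [x'y uy]] := chart_basis x'.
have xy i : mgap x (y i) < e by apply: mgap_rho2 xx' _; exact: rho16.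
have x'y' i : mgap x' (y i) < e by exact/rho_e/rho16.
have [iso _] := FP x; have [iso' _] := FP x'.
have [i j|T lT TP] := @lorentz_ext _ (fun i => F x' (y i)) (fun i => F x (y i)) _ uy.
  by rewrite iso ?iso'.
by exists T => // z xz x'z; apply: TP => i; rewrite iso ?iso'.
Qed.

Let flat_refl g : ok g -> flat g g.
Proof. by split; rewrite ?mgapxx. Qed.

Let flat_sym g g' : ok g -> ok g' -> flat g g' -> flat g' g.
Proof. by move=> _ _ [gg fl]; split=> [|y a b]; [rewrite mgap_sym|rewrite fl]. Qed.

(** A point in the charts at [x] and [x''] may lie outside the one at [x']. Both germs are therefore
    compared on a basis near [x''], which lies in all three charts, and linearity does the rest. *)
Let mflat_trans g g' g'' : flat g g' -> flat g' g'' ->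
  mgap g.1.1 g''.1.1 < rho -> flat g g''.
Proof.
case: g => [[x B] q]; case: g' => [[x' B'] q']; case: g'' => [[x'' B''] q''] /=.
move=> [/= xx f1] [/= xx' f2] xx''; split=> //= y xy x''y.
have [T lT TP] := transition (rho16 xx'').
rewrite -TP// -mulmxA; congr (_ *m _).
have [z [x''z uz]] := chart_basis x''.
apply: (lorentz_eq uz) => i; rewrite mulmxA.
have z''e := rho_e (rho16 (x''z i)).
have ze : mgap x (z i) < e by apply: mgap_rho2 (rho16 xx'') (rho16 (x''z i)).
have z'e : mgap x' (z i) < e by apply: mgap_rho2 (rho16 xx') (rho16 (x''z i)).
by rewrite TP// f1// f2.
Qed.

Let flat_gap g g' : ok g -> ok g' -> flat g g' -> hgap g.2 g'.2 = mgap g.1.1 g'.1.1.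
Proof.
case: g => [[x B] q]; case: g' => [[x' B'] q'] [/= lB qE] [/= lB' qE'] [/= xx fl].
have xe := rho_e (rho16 xx); have [iso _] := FP x.
have := lform_hvec q q'; rewrite -qE -qE' -fl// lform_lorentz// lform_hvec iso//.
by move=> /addrI.
Qed.

Let flat_eq g g' : ok g -> ok g' -> flat g g' -> g.2 = g'.2 -> g = g'.
Proof.
move=> og og' fl gg'; have := flat_gap og og' fl; rewrite gg' hgapxx => /esym/mgap0.
move: og og' fl gg'; case: g => [[x B] q]; case: g' => [[x' B'] q'] /=.
move=> _ _ [/= _ fl] <- xx; rewrite -xx in fl *; congr (_, _, _).
have [z [xz uz]] := chart_basis x.
by apply: (lorentz_eq uz) => i; apply: fl; exact/rho_e/rho16.
Qed.

Let mtransport g x' : ok g -> mgap g.1.1 x' < rho ->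
  exists g', [/\ ok g', g'.1.1 = x' & flat g g'].
Proof.
case: g => [[x B] q] [/= lB qE] xx'.
have [T lT TP] := transition (rho16 xx'); have lTB := lorentzM lT lB.
have [q' q'E] := hsheetP (lTB.2 _ (hsheet_hvec (F x' x'))).
exists (x', T *m B, q'); split=> //; split=> //= y xy x'y.
by rewrite mulmxA TP.
Qed.

Let transport g q' : ok g -> hgap g.2 q' < rho ->
  exists g', [/\ ok g', g'.2 = q' & flat g g'].
Proof.
case: g => [[x B] q] og qq'; have [/= lB qE] := og; rewrite /= in qq'.
have [r rE] := lorentz_surj q' lB; have [iso onto] := FP x.
have xr : hgap (F x x) r = hgap q q'.
  have := lform_lorentz (hvec (F x x)) (hvec r) lB.
  by rewrite qE rE !lform_hvec => /addrI.
have [|x' xx' x'r] := onto r; first by rewrite xr; exact/rho_e/rho16.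
have gxx' : mgap x x' < rho by rewrite -(iso _ _ (self x) xx') x'r xr.
have [[[y B'] q''] [og' /= yx' fl]] := mtransport og gxx'.
subst y.
exists (x', B', q''); split=> //=; apply: hvec_inj.
have [_ /= <-] := og'; have [_ /= <-] := fl => //.
by rewrite x'r rE.
Qed.

(** Smallness is now given in the half-space instead of [M]. The two flat steps carry the value at
    [x''] back to the chart at [x], which identifies the two gaps. *)
Let transH g g' g'' : ok g -> ok g' -> ok g'' -> flat g g' -> flat g' g'' ->
  hgap g.2 g''.2 < rho -> flat g g''.
Proof.
move=> og og' og'' fl fl' gg''; apply: (mflat_trans fl fl').
suff <- : hgap g.2 g''.2 = mgap g.1.1 g''.1.1 by [].
move: og og' og'' fl fl' {gg''}.
case: g => [[x B] q]; case: g' => [[x' B'] q']; case: g'' => [[x'' B''] q''] /=.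
move=> [/= lB qE] [/= lB' qE'] [/= lB'' qE''] [/= xx f1] [/= xx' f2].
have xe := rho_e (mgap_rho1 xx xx'); have [iso _] := FP x.
have := lform_hvec q q''; rewrite -qE -qE'' -f2//; last exact/rho_e/rho16.
rewrite -f1//; last exact/rho_e/rho16.
by rewrite lform_lorentz// lform_hvec iso// => /addrI.
Qed.

(** [flat_section] extends the germ of the chart at [p] to a germ over each point [h] of the
    half-space, and [cov h] is its base point in [M]. Continuation by steps of fixed size is
    possible as the charts have a common radius. *)
Lemma developed_covering (p : M) : exists (cov : hyp3 R -> M) (o : hyp3 R) (d : R),
  [/\ 0 < d, d <= 2^-1, cov o = p,
      forall h h', hgap h h' < d -> mgap (cov h) (cov h') = hgap h h' &
      forall h x, mgap (cov h) x < d -> exists2 h', cov h' = x & hgap h h' < d].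
Proof.
pose g0 : germ := (p, 1%:M, F p p).
have og0 : ok g0 by split; [exact: lorentz1|rewrite mulmx1].
(* Two steps of size [d] then compose to one of size [rho], as [near2] asks. *)
pose d := rho / 16.
have d0 : 0 < d by rewrite divr_gt0.
have d1 : d <= 2^-1 by have := e0; have := e12; rewrite /d /rho; lra.
have dr r : r < d -> r < rho by rewrite /d; have := rho0; lra.
have [s [s0 sP sF]] : exists s : hyp3 R -> germ, [/\ s g0.2 = g0,
    forall h, ok (s h) /\ (s h).2 = h &
    forall h h', hgap h h' < d -> flat (s h) (s h')].
  apply: (@flat_section _ _ _ (fun h h' => hgap h h' < d)
     (fun h h' => hgap h h' < rho) hmix ok snd flat g0).
  - exact: og0.
  - by move=> h /=; rewrite hgapxx.
  - move=> a b c ab bc; rewrite (_ : rho = 16 * d); last by rewrite /d; lra.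
    exact: hgap_triangle_small ab bc.
  - by move=> h; exact: hmix0.
  - by move=> h; exact: hmix1.
  - by move=> t; exact: hmixxx.
  - by move=> t h h' _ _; apply: le_lt_trans; exact: hgap_hmix.
  - move=> h; have [N0 N0P] := hmix_steps (hgap g0.2 h) d0.
    exists N0 => N k NN kN; apply: N0P NN _ _ _ _ (lexx _) _.
    rewrite distrC -mulrBl -natrB// subSnn.
    by rewrite mul1r ger0_norm ?invr_ge0.
  - exact: flat_refl.
  - exact: flat_sym.
  - by move=> g h og /dr; exact: transport.
  - exact: flat_eq.
  - exact: transH.
exists (fun h => (s h).1.1), (F p p), d; split=> //.
- by rewrite -[F p p]/g0.2 s0.
- move=> h h' hh'; have [og gh] := sP h; have [og' gh'] := sP h'.
  by rewrite -(flat_gap og og' (sF _ _ hh')) gh gh'.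
- move=> h x hx; have [og gh] := sP h.
  have [g' [og' g'x fl]] := mtransport og (dr _ hx).
  have gg : hgap h g'.2 < d by rewrite -{1}gh (flat_gap og og' fl) g'x.
  exists g'.2 => //; rewrite -g'x.
  have [og2 gh2] := sP g'.2.
  (* The germ [g'] continued along [M] and the section at the same point are both flat neighbours of
     [s h]. *)
  suff <- : g' = s g'.2 by [].
  apply: (flat_eq og' og2); last by rewrite gh2.
  apply: (transH og' og og2); [exact: flat_sym|exact: sF|].
  by rewrite gh2 hgapxx.
Qed.

End Developing.

(** * Path lifting and the orbit map *)

Section UniformContinuity.
Context {R : realType} {M : metricType R}.

(** A Lebesgue number argument; only [x] has to lie in [K]. *)
Lemma compact_mgap_unif (T : pseudoMetricType R) (K : set T) (f : T -> M) (e : R) :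
  compact K -> continuous f -> 0 < e -> exists2 d : R, 0 < d &
  forall x y, K x -> ball x d y -> mgap (f x) (f y) < e.
Proof.
move=> cK cf e0; pose c := Num.min e 2^-1 / 16.
have c0 : 0 < c by rewrite divr_gt0// lt_min e0 invr_gt0 ltr0n.
have c1 : c <= 2^-1.
  have : Num.min e 2^-1 <= 2^-1 by rewrite ge_min lexx orbT.
  by rewrite /c; lra.
have c16 : 16 * c <= e.
  have : Num.min e 2^-1 <= e by rewrite ge_min lexx.
  by rewrite /c; lra.
have : \forall d \near (0 : R)^'+, forall x, K x -> forall y, ball x d y -> mgap (f x) (f y) < e.
  move/compact_near_coveringP : cK; apply => x Kx.
  have /nbhs_ballP[r /= r0 rP] := cf x _ (nbhs_mgap (f x) c0).
  exists (ball x (r / 2), [set d | 0 < d < r / 2]).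
    split; first by apply: nbhsx_ballx; rewrite divr_gt0.
    near=> d; apply/andP; split; near: d; first exact: nbhs_right_gt.
    by apply: nbhs_right_lt; rewrite divr_gt0.
  move=> [x' d] /= [xx' /andP[d0 dr]] y x'y.
  apply: lt_le_trans c16; apply: (@mgap_triangle_small _ _ (f x)) => //.
    rewrite mgap_sym; apply: (rP x'); apply: le_ball xx'.
    by lra.
  apply: (rP y); rewrite (splitr r); apply: ball_triangle xx' _.
  by apply: le_ball x'y; exact: ltW.
move=> dP; have : \forall d \near (0 : R)^'+, 0 < d /\
    forall x, K x -> forall y, ball x d y -> mgap (f x) (f y) < e.
  by near=> d; split; near: d => //; exact: nbhs_right_gt.
by move=> /filter_ex[d [d0 dF]]; exists d => // x y Kx; exact: dF.
Unshelve. all: by end_near. Qed.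

End UniformContinuity.

(** * Continuity of maps into the half-space *)

Section HalfSpaceContinuity.
Context {R : realType}.

Definition hcts {T : topologicalType} (U : T -> hyp3 R) :=
  [/\ continuous (fun t => hyp3_x (U t)), continuous (fun t => hyp3_y (U t)) &
      continuous (fun t => hyp3_z (U t))].

Lemma hgap_coord (p : hyp3 R) (c : R) : 0 < c -> exists2 e : R, 0 < e &
  forall q, hgap p q < e -> [/\ `|hyp3_x p - hyp3_x q| < c,
    `|hyp3_y p - hyp3_y q| < c & `|hyp3_z p - hyp3_z q| < c].
Proof.
move=> c0; have p0 := hyp3_z_gt0 p.
(* For gaps at most 1, [hgap_height] gives [hyp3_z q <= 4 * hyp3_z p], so the numerator is below
   [8 * e * hyp3_z p ^+ 2]. *)
pose e := Num.min 1 (c ^+ 2 / (8 * hyp3_z p ^+ 2)).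
have z8 : 0 < 8 * hyp3_z p ^+ 2 by rewrite mulr_gt0 ?exprn_gt0.
have e0 : 0 < e by rewrite lt_min ltr01 divr_gt0// exprn_gt0.
have e1 : e <= 1 by rewrite ge_min lexx.
have ec : e * (8 * hyp3_z p ^+ 2) <= c ^+ 2.
  by rewrite -ler_pdivlMr// ge_min lexx orbT.
exists e => // q pq.
have hq := hgap_height q p; rewrite hgap_sym in hq.
have q0 := hyp3_z_gt0 q; have g0 := hgap_ge0 p q.
have : (hyp3_x p - hyp3_x q) ^+ 2 + (hyp3_y p - hyp3_y q) ^+ 2 +
   (hyp3_z p - hyp3_z q) ^+ 2 < c ^+ 2.
  apply: lt_le_trans ec; move: (pq); rewrite hgap_lt => /lt_le_trans; apply.
  rewrite ler_wpM2l ?(ltW e0)// expr2.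
  have : hyp3_z q <= 4 * hyp3_z p.
    apply: le_trans hq _; rewrite ler_wpM2r ?(ltW p0)//.
    have := lt_le_trans pq e1; lra.
  move=> h; have h' : 0 <= 4 * hyp3_z p - hyp3_z q by lra.
  by have := mulr_ge0 (ltW p0) h'; lra.
have := sqr_ge0 (hyp3_x p - hyp3_x q); have := sqr_ge0 (hyp3_y p - hyp3_y q).
have := sqr_ge0 (hyp3_z p - hyp3_z q) => hz hy hx h.
have small (u : R) : u ^+ 2 < c ^+ 2 -> `|u| < c.
  by move=> uc; rewrite -(ltr_pXn2r (ltn0Sn 1)) ?nnegrE ?real_normK ?num_real ?normr_ge0// ltW.
by split; apply: small; lra.
Qed.

Lemma near_hgap_hcts (T : topologicalType) (U : T -> hyp3 R) :
  (forall t (e : R), 0 < e -> \forall t' \near t, hgap (U t) (U t') < e) -> hcts U.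
Proof.
move=> H.
have coord (f : hyp3 R -> R) : (forall p (c : R), 0 < c -> exists2 e : R, 0 < e &
    forall q, hgap p q < e -> `|f p - f q| < c) -> continuous (fun t => f (U t)).
  move=> fP t; apply/cvgrPdist_lt => c c0; have [e e0 eP] := fP (U t) c c0.
  by apply: filterS (H t e e0) => t' /eP.
by split; apply: coord => p c /(hgap_coord p)[e e0 eP]; exists e => // q /eP[].
Qed.

Lemma hcts_near_hgap (T : topologicalType) (U : T -> hyp3 R) t (e : R) :
  hcts U -> 0 < e -> \forall t' \near t, hgap (U t) (U t') < e.
Proof.
move=> [cx cy cz] e0.
have zz : \forall t' \near t, (hyp3_x (U t) - hyp3_x (U t')) ^+ 2 +
   (hyp3_y (U t) - hyp3_y (U t')) ^+ 2 + (hyp3_z (U t) - hyp3_z (U t')) ^+ 2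
   - e * (2 * hyp3_z (U t) * hyp3_z (U t')) < 0.
  have cc : continuous (fun t' : T => (hyp3_x (U t) - hyp3_x (U t')) ^+ 2 +
   (hyp3_y (U t) - hyp3_y (U t')) ^+ 2 + (hyp3_z (U t) - hyp3_z (U t')) ^+ 2
   + - (e * (2 * hyp3_z (U t) * hyp3_z (U t')))).
    have sq (f : T -> R) : continuous f -> continuous (fun t' => (f t - f t') ^+ 2).
      move=> cf; have c1 : continuous (fun t' => f t + - f t').
        by apply: add_cts; [exact: cst_cts|exact: opp_cts].
      by under eq_fun do rewrite expr2; exact: mul_cts.
    apply: add_cts.
      by apply: add_cts; [apply: add_cts|]; exact: sq.
    apply: opp_cts; apply: mul_cts; first exact: cst_cts.
    by apply: mul_cts => //; exact: cst_cts.
  apply: (cvgr_lt _ (cc t)).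
  rewrite /= !subrr expr0n /= !addr0 add0r oppr_lt0.
  by rewrite !mulr_gt0// hyp3_z_gt0.
by apply: filterS zz => t'; rewrite subr_lt0 hgap_lt.
Qed.

Lemma hcts_comp (T S : topologicalType) (f : T -> S) (U : S -> hyp3 R) :
  continuous f -> hcts U -> hcts (fun t => U (f t)).
Proof.
move=> cf [cx cy cz]; split.
- exact: (comp_cts cx cf).
- exact: (comp_cts cy cf).
- exact: (comp_cts cz cf).
Qed.

Lemma hcts_hmix (T : topologicalType) (f : T -> R) (U V : T -> hyp3 R) :
  continuous f -> hcts U -> hcts V -> hcts (fun t => hmix (f t) (U t) (V t)).
Proof.
move=> cf [cx cy cz] [cx' cy' cz'].
have cc : continuous (fun t => clamp (f t)) by exact: comp_cts clamp_cts cf.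
have c1 : continuous (fun t => 1 + - clamp (f t)).
  by apply: add_cts; [exact: cst_cts|exact: opp_cts].
by split; apply: add_cts; exact: mul_cts.
Qed.

(** Uniformity on all of [R] is available because lifted paths project to clamped ones. *)
Definition hucts (c : R -> hyp3 R) := forall e : R, 0 < e -> exists2 d : R, 0 < d &
  forall s t, `|s - t| <= d -> hgap (c s) (c t) < e.

Lemma hucts_hcts c : hucts c -> hcts c.
Proof.
move=> cc; apply: near_hgap_hcts => t e /cc[d d0 dP].
apply/nbhs_ballP; exists d => // s /= ts; apply: dP; exact: ltW.
Qed.

Lemma hucts_hmix p q : hucts (fun s => hmix s p q).
Proof.
move=> e e0; have [N0 N0P] := hmix_steps (hgap p q) e0.
exists N0.+1%:R^-1; first by rewrite invr_gt0 ltr0n.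
by move=> s t st; apply: (N0P N0.+1).
Qed.

End HalfSpaceContinuity.

(** As for [rho], the two factors 16 allow two triangle inequalities below [d]. *)
Definition lift_scale {R : realType} (d : R) : R := d / 16 / 16.

(** * Lifting squares and loops through the local isometry *)

Section PathLifting.
Context {R : realType} {M : metricType R} {cov : hyp3 R -> M} {d : R}.
Context (d0 : 0 < d) (d12 : d <= 2^-1)
  (cov_iso : forall h h', hgap h h' < d -> mgap (cov h) (cov h') = hgap h h')
  (cov_onto : forall h x, mgap (cov h) x < d -> exists2 h', cov h' = x & hgap h h' < d).

Let k := lift_scale d.

Let k0 : 0 < k. Proof. by rewrite !divr_gt0. Qed.

Let kd r : r < k -> r < d. Proof. by have := d0; rewrite /k /lift_scale; lra. Qed.

Let hgap_k1 (p q r : hyp3 R) : hgap p q < k -> hgap q r < k -> hgap p r < 16 * k.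
Proof. by apply: hgap_triangle_small; have := d0; have := d12; rewrite /k /lift_scale; lra. Qed.

Let hgap_k2 (p q r : hyp3 R) : hgap p q < 16 * k -> hgap q r < 16 * k -> hgap p r < d.
Proof.
have := d0; have := d12 => ? ?.
move=> pq qr; rewrite (_ : d = 16 * (16 * k)); last by rewrite /k /lift_scale; lra.
by apply: (@hgap_triangle_small _ q) => //; rewrite /k /lift_scale; lra.
Qed.

Let k16 r : r < k -> r < 16 * k. Proof. by have := k0; lra. Qed.

Let k16d r : r < 16 * k -> r < d. Proof. by have := d0; rewrite /k /lift_scale; lra. Qed.

Lemma lift_eq h h' : hgap h h' < d -> cov h = cov h' -> h = h'.
Proof. by move=> hh e; apply: hgap0; rewrite -cov_iso// e mgapxx. Qed.

Lemma covering_cts (T : topologicalType) (U : T -> hyp3 R) :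
  hcts U -> continuous (cov \o U).
Proof.
move=> cU t A /nbhs_mgapP[e e0 eA].
have m0 : 0 < Num.min e d by rewrite lt_min e0.
apply: filterS (hcts_near_hgap t cU m0) => t'; rewrite lt_min => /andP[te td].
by apply: eA; rewrite /= cov_iso.
Qed.

(** Another use of [flat_section]: the base is the plane, contracted linearly to the origin, the
    elements over it are points of the half-space with the prescribed image, and flat means
    close. *)
Lemma lift_square (F : R * R -> M) (h0 : hyp3 R) : continuous F -> cov h0 = F (0, 0) ->
  exists G : R * R -> hyp3 R, [/\ G (0, 0) = h0,
    forall x, cov (G x) = F (clamp x.1, clamp x.2) &
    forall e : R, 0 < e -> exists2 c : R, 0 < c & forall x y,
      `|x.1 - y.1| <= c -> `|x.2 - y.2| <= c -> hgap (G x) (G y) < e].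
Proof.
move=> cF hF.
pose F' (x : R * R) := F (clamp x.1, clamp x.2).
have F'cts (e : R) : 0 < e -> exists2 c : R, 0 < c & forall x y,
    `|x.1 - y.1| <= c -> `|x.2 - y.2| <= c -> mgap (F' x) (F' y) < e.
  move=> e0; have cI : compact (`[0, 1]%classic `*` `[0, 1]%classic : set (R * R)).
    by apply: compact_setX; exact: segment_compact.
  have [c c0 cP] := compact_mgap_unif cI cF e0.
  exists (c / 2); first by rewrite divr_gt0.
  move=> x y xy1 xy2; apply: cP; first by split; have := clampP; apply.
  split; rewrite /ball /=; apply: le_lt_trans (clamp_lip _ _) _; lra.
have [c c0 cP] := F'cts k k0.
pose ok (u : (R * R) * hyp3 R) := cov u.2 = F' u.1.
pose flat (u v : (R * R) * hyp3 R) := hgap u.2 v.2 < k.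
pose near1 (c : R) (x y : R * R) := `|x.1 - y.1| <= c /\ `|x.2 - y.2| <= c.
pose mix (t : R) (x y : R * R) := ((1 - t) * x.1 + t * y.1, (1 - t) * x.2 + t * y.2).
pose u0 : (R * R) * hyp3 R := ((0, 0), h0).
have c2 : 0 < c / 2 by rewrite divr_gt0.
(* A gap below [d] equals the gap of the images, which continuity of [F'] makes smaller than [k]. *)
have flat_gap x y h h' : near1 c x y -> cov h = F' x -> cov h' = F' y ->
    hgap h h' < d -> hgap h h' < k.
  by move=> [xy1 xy2] hx hy /cov_iso <-; rewrite hx hy; exact: cP.
have [s [s0 sP sF]] : exists s : R * R -> (R * R) * hyp3 R, [/\ s u0.1 = u0,
    forall x, ok (s x) /\ (s x).1 = x &
    forall x y, near1 (c / 2) x y -> flat (s x) (s y)].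
  apply: (@flat_section R _ _ (near1 (c / 2)) (near1 c) mix ok fst flat u0).
  - by rewrite /ok /F' /= !clamp_le0.
  - by move=> x; rewrite /near1 !subrr normr0 ltW.
  - move=> x y z [xy1 xy2] [yz1 yz2]; split.
      by rewrite -(subrKA y.1) (splitr c) (le_trans (ler_normD _ _))// lerD.
    by rewrite -(subrKA y.2) (splitr c) (le_trans (ler_normD _ _))// lerD.
  - by move=> x; rewrite /mix /= !mulr0 !mul0r !addr0.
  - by move=> [x y]; rewrite /mix /= !mulr0 !mul1r !add0r.
  - by move=> t; rewrite /mix /= !mulr0 !addr0.
  - move=> t x y t0 t1 [xy1 xy2]; rewrite /near1 /mix /= !mulr0 !add0r -!mulrBr !normrM.
    by rewrite !(ger0_norm t0); split; (apply: le_trans (ler_piMl _ t1) _ => //).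
  - move=> x; pose C := (`|x.1| + `|x.2|) / (c / 2).
    exists (Num.truncn C).+1 => N j NN jN.
    have CN : C < N%:R by apply: lt_le_trans (truncnS_gt _) _; rewrite ler_nat.
    have N0 : 0 < N%:R :> R by rewrite ltr0n (leq_trans _ NN).
    have b (a : R) : `|a| <= `|x.1| + `|x.2| ->
        `|j%:R / N%:R * a - j.+1%:R / N%:R * a| <= c / 2.
      move=> ax; rewrite -mulrBl -mulrBl !normrM distrC -natrB// subSnn normr1 mul1r.
      rewrite ger0_norm ?invr_ge0// mulrC ler_pdivrMr//.
      apply: le_trans ax _; rewrite mulrC -ler_pdivrMr//; exact: ltW.
    rewrite /near1 /mix /= !mulr0 !add0r.
    by split; apply: b; rewrite ?lerDl ?lerDr normr_ge0.
  - by move=> u _; rewrite /flat hgapxx.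
  - by move=> u v _ _; rewrite /flat hgap_sym.
  - move=> [x h] y /= hx [xy1 xy2]; rewrite /ok /= in hx.
    have xyk : mgap (cov h) (F' y) < k.
      by rewrite hx; apply: cP; lra.
    have [h' h'y hh'] := cov_onto (kd xyk).
    exists (y, h'); split=> //; rewrite /flat /= -cov_iso// h'y//.
  - move=> [x h] [y h']; rewrite /ok /flat /= => hx hy hh' xy.
    by rewrite -xy in hy *; congr (_, _); apply: lift_eq; [exact: kd|rewrite hx hy].
  - move=> [x h] [y h'] [z h'']; rewrite /ok /flat /= => hx hy hz hh hh' xz.
    by apply: flat_gap xz hx hz _; exact/k16d/(hgap_k1 hh hh').
exists (fun x => (s x).2); split.
- by rewrite -[(0, 0)]/u0.1 s0.
- by move=> x; have [os sx] := sP x; rewrite -[in RHS]sx.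
- move=> e /F'cts[b b0 bP]; exists (Num.min (c / 2) b); first by rewrite lt_min c2.
  move=> x y; rewrite !le_min => /andP[xc1 xb1] /andP[xc2 xb2].
  have [ox sx] := sP x; have [oy sy] := sP y.
  rewrite -cov_iso; last by apply: kd; exact: sF.
  by rewrite ox oy sx sy; exact: bP.
Qed.

(** Going from 0 to [s] by small steps: one step lets the gap grow from [k] to less than [d], where
    [cov] is isometric, and the closeness of the images brings it below [k] again. *)
Lemma lift_close (c c' : R -> hyp3 R) : hucts c -> hucts c' ->
  (forall s, s \in `[0, 1] -> mgap (cov (c s)) (cov (c' s)) < k) ->
  hgap (c 0) (c' 0) < k -> forall s, s \in `[0, 1] -> hgap (c s) (c' s) < k.
Proof.
move=> uc uc' cc' c00 s s01.
have [e e0 eP] := uc k k0; have [e' e'0 e'P] := uc' k k0.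
pose C := (Num.min e e')^-1.
have m0 : 0 < Num.min e e' by rewrite lt_min e0.
pose N := (Num.truncn C).+1.
have CN : C < N%:R by exact: truncnS_gt.
have N0 : 0 < N%:R :> R by rewrite ltr0n.
have Nm : N%:R^-1 <= Num.min e e' by rewrite -[leRHS]invrK lef_pV2 ?posrE ?invr_gt0// ltW.
have /andP[s0 s1] : 0 <= s <= 1 by move: s01; rewrite in_itv.
pose t (j : nat) : R := j%:R / N%:R * s.
have t01 j : (j <= N)%N -> t j \in `[0, 1].
  move=> jN; rewrite in_itv /=; apply/andP; split; first by rewrite mulr_ge0// divr_ge0.
  rewrite /t -[leRHS]mulr1; apply: ler_pM => //.
  by rewrite ler_pdivrMr// mul1r ler_nat.
have step j : `|t j - t j.+1| <= Num.min e e'.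
  apply: le_trans Nm; rewrite /t -mulrBl -mulrBl !normrM distrC -natrB// subSnn normr1 mul1r.
  rewrite (ger0_norm s0) ger0_norm ?invr_ge0//.
  by rewrite ler_piMr// invr_ge0 ltW.
suff H j : (j <= N)%N -> hgap (c (t j)) (c' (t j)) < k.
  by have := H N (leqnn N); rewrite /t divff ?mul1r// gt_eqF.
elim: j => [_|j IHj jN]; first by rewrite /t !mul0r.
have := step j; rewrite le_min => /andP[/eP h1 /e'P h2].
rewrite hgap_sym in h1; have h3 := IHj (ltnW jN).
have hd : hgap (c (t j.+1)) (c' (t j.+1)) < d.
  by apply: hgap_k2 (hgap_k1 h1 h3) (k16 h2).
by rewrite -cov_iso//; apply: cc'; exact: t01.
Qed.

Lemma lift_uniq (c c' : R -> hyp3 R) : hucts c -> hucts c' ->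
  (forall s, s \in `[0, 1] -> cov (c s) = cov (c' s)) -> c 0 = c' 0 ->
  forall s, s \in `[0, 1] -> c s = c' s.
Proof.
move=> uc uc' cc' c00 s s01; apply: lift_eq (cc' s s01); apply: kd.
apply: lift_close => //; last by rewrite c00 hgapxx.
by move=> t t01; rewrite cc'// mgapxx.
Qed.

Lemma hucts_row (G : R * R -> hyp3 R) (f : R -> R * R) :
  (forall e : R, 0 < e -> exists2 c : R, 0 < c & forall x y,
      `|x.1 - y.1| <= c -> `|x.2 - y.2| <= c -> hgap (G x) (G y) < e) ->
  (forall s t, `|(f s).1 - (f t).1| <= `|s - t| /\ `|(f s).2 - (f t).2| <= `|s - t|) ->
  hucts (G \o f).
Proof.
move=> uG ff e /uG[c c0 cP]; exists c => // s t st.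
by have [f1 f2] := ff s t; apply: cP; exact: le_trans st.
Qed.

Context {p : M}.
Implicit Types (a b : loop R p) (h q r : hyp3 R).

Definition lift_end h a q := exists c : R -> hyp3 R,
  [/\ hucts c, c 0 = h, c 1 = q & forall s, s \in `[0, 1] -> cov (c s) = a s].

Let I0 : (0 : R) \in `[0, 1]. Proof. by rewrite in_itv /= lexx ler01. Qed.
Let I1 : (1 : R) \in `[0, 1]. Proof. by rewrite in_itv /= lexx ler01. Qed.

Lemma lift_end_ex h a : cov h = p -> exists q, lift_end h a q.
Proof.
move=> hp; pose F (x : R * R) := gfun a x.1.
have cF : continuous F by exact: comp_cts (@gfun_cts _ _ _ a) (@fst_cts _ _).
have hF : cov h = F (0, 0) by rewrite hp /F gfun_le0.
have [G [G0 GF uG]] := lift_square cF hF.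
exists (G (1, 0)), (fun s => G (s, 0)); split=> //.
  by apply: (hucts_row (f := fun s => (s, 0))) => // s t /=; rewrite subrr normr0.
by move=> s s01; rewrite GF /F /= clampE// gfunE.
Qed.

Lemma lift_end_fiber h a q : lift_end h a q -> cov q = p.
Proof. by move=> [c [_ _ <- ->//]]; rewrite loop1. Qed.

Lemma lift_end_start h a q : lift_end h a q -> cov h = p.
Proof. by move=> [c [_ <- _ ->//]]; rewrite loop0. Qed.

Lemma lift_end_close h a q b r : lift_end h a q -> lift_end h b r ->
  (forall s, s \in `[0, 1] -> mgap (a s) (b s) < k) -> q = r.
Proof.
move=> haq hbr ab; have pq := lift_end_fiber haq; have pr := lift_end_fiber hbr.
case: haq hbr => c [uc c0 c1 ca] [c' [uc' c'0 c'1 c'b]].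
apply: lift_eq; last by rewrite pq pr.
apply: kd; rewrite -c1 -c'1; apply: lift_close => //.
  by move=> s s01; rewrite ca// c'b// ab.
by rewrite c0 c'0 hgapxx.
Qed.

(** In the lifted homotopy the two vertical sides lift constant paths, hence are constant. *)
Lemma lift_end_homotopic h a q b r : lift_end h a q -> lift_end h b r ->
  homotopic a b -> q = r.
Proof.
move=> haq hbr /homotopicE[F [cF F0 F1 Fl Fr]].
have hp := lift_end_start haq.
have hF : cov h = F (0, 0) by rewrite Fl.
have [G [G0 GF uG]] := lift_square cF hF.
have rowh (y : R) : hucts (fun s => G (s, y)).
  by apply: (hucts_row (f := fun s => (s, y))) => // s t /=; rewrite subrr normr0.
have rowv (y : R) : hucts (fun s => G (y, s)).
  by apply: (hucts_row (f := fun s => (y, s))) => // s t /=; rewrite subrr normr0.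
have left s : s \in `[0, 1] -> G (0, s) = h.
  rewrite -G0; apply: (@lift_uniq (fun s => G (0, s)) (fun=> G (0, 0))) => //.
  - by move=> e e0; exists 1 => // *; rewrite hgapxx.
  - by move=> t t01; rewrite !GF /= !Fl// clamp_le0.
have right s : s \in `[0, 1] -> G (1, s) = G (1, 0).
  apply: (@lift_uniq (fun s => G (1, s)) (fun=> G (1, 0))) => //.
  - by move=> e e0; exists 1 => // *; rewrite hgapxx.
  - by move=> t t01; rewrite !GF /= !Fr// clamp_ge1.
case: haq hbr => c [uc c0 c1 ca] [c' [uc' c'0 c'1 c'b]].
rewrite -c1 -c'1.
rewrite (@lift_uniq c (fun s => G (s, 0)))//; last 2 first.
- by move=> s s01; rewrite GF /= (clampE s01) clamp_le0// F0 ca// gfunE.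
- by rewrite c0 G0.
rewrite (@lift_uniq c' (fun s => G (s, 1)))//; last 2 first.
- by move=> s s01; rewrite GF /= (clampE s01) clamp_ge1// F1 c'b// gfunE.
- by rewrite c'0 left.
by rewrite (right 1).
Qed.

(** The half-space is convex: the segments between the two lifts project to a homotopy, which fixes
    the common ends. *)
Lemma homotopic_lift_end h a b q : lift_end h a q -> lift_end h b q -> homotopic a b.
Proof.
move=> [c [uc c0 c1 ca]] [c' [uc' c'0 c'1 c'b]].
apply: (@homotopicI _ _ _ _ _ (cov \o (fun x => hmix x.2 (c x.1) (c' x.1)))).
- apply: covering_cts; apply: hcts_hmix; first exact: snd_cts.
    exact: hcts_comp (@fst_cts _ _) (hucts_hcts uc).
  exact: hcts_comp (@fst_cts _ _) (hucts_hcts uc').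
- by move=> s s01 /=; rewrite hmix0 ca.
- by move=> s s01 /=; rewrite hmix1 c'b.
- move=> t t01 /=; rewrite c0 c'0 c1 c'1 !hmixxx; split.
    by rewrite -c0 ca// loop0.
  by rewrite -c1 ca// loop1.
Qed.

(** By uniqueness of lifts, the two halves of the lift of the concatenation are the given lifts. *)
Lemma lift_end_cat h a q b r : lift_end h a q -> lift_end q b r ->
  lift_end h (loop_cat a b) r.
Proof.
move=> haq hbr; have [t' ht] := lift_end_ex (loop_cat a b) (lift_end_start haq).
suff -> : r = t' by [].
case: haq hbr ht => c [uc c0 c1 ca] [c' [uc' c'0 c'1 c'b]] [f [uf f0 f1 fE]].
have half (v : R) : hucts (fun s => f (2^-1 * s + v)).
  move=> e /uf[x x0 xP]; exists x => // s t st; apply: xP.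
  rewrite opprD addrACA subrr addr0 -mulrBr normrM ger0_norm ?invr_ge0//; lra.
have q1 : f 2^-1 = q.
  have -> : f 2^-1 = f (2^-1 * 1 + 0) by congr f; lra.
  rewrite -c1; apply: (@lift_uniq (fun s => f (2^-1 * s + 0)) c) => //; last first.
    by rewrite mulr0 addr0 f0 c0.
  move=> s s01; have /andP[s0 s1] : 0 <= s <= 1 by move: s01; rewrite in_itv.
  rewrite fE; last by rewrite in_itv /=; apply/andP; split; lra.
  rewrite loop_catE; last by rewrite in_itv /=; apply/andP; split; lra.
  rewrite ifT; last by lra.
  by rewrite (_ : 2 * _ = s) ?gfunE ?ca//; lra.
rewrite -c'1 -f1 (_ : f 1 = f (2^-1 * 1 + 2^-1)); last by congr f; lra.
apply: (@lift_uniq c' (fun s => f (2^-1 * s + 2^-1))) => //; last first.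
  by rewrite mulr0 add0r q1 c'0.
move=> s s01; have /andP[s0 s1] : 0 <= s <= 1 by move: s01; rewrite in_itv.
rewrite fE; last by rewrite in_itv /=; apply/andP; split; lra.
rewrite loop_catE; last by rewrite in_itv /=; apply/andP; split; lra.
case: leP => hs.
  have -> : s = 0 by lra.
  by rewrite mulr0 add0r divff ?pnatr_eq0// gfun_ge1// c'b// loop0.
by rewrite (_ : 2 * _ - 1 = s) ?gfunE ?c'b//; lra.
Qed.

Lemma segment_loop h q : cov h = p -> cov q = p -> exists a,
  lift_end h a q /\ forall s, s \in `[0, 1] -> a s = cov (hmix s h q).
Proof.
move=> hp qp; pose c (s : R) := cov (hmix s h q).
have cc : {within `[0, 1]%classic, continuous c}.
  apply: continuous_subspaceT; apply: (@covering_cts _ (fun s => hmix s h q)).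
  exact/hucts_hcts/hucts_hmix.
have c0 : c 0 = p by rewrite /c hmix0.
have c1 : c 1 = p by rewrite /c hmix1.
exists (Loop cc c0 c1); split=> //; exists (fun s => hmix s h q); split=> //.
- exact: hucts_hmix.
- exact: hmix0.
- exact: hmix1.
Qed.

End PathLifting.

(** * The orbit map and its coarse geometry *)

Section OrbitMap.
Context {R : realType} {M : metricType R} {cov : hyp3 R -> M} {d : R} {o : hyp3 R}
  {p : M} {S : seq (pi1 R p)} (genS : generates S).
Context (d0 : 0 < d) (d12 : d <= 2^-1) (covo : cov o = p)
  (cov_iso : forall h h', hgap h h' < d -> mgap (cov h) (cov h') = hgap h h')
  (cov_onto : forall h x, mgap (cov h) x < d -> exists2 h', cov h' = x & hgap h h' < d)
  (compactM : compact [set: M]) (connectedM : connected [set: M]).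
Local Open Scope quotient_scope.

Let k : R := lift_scale d.

Let k0 : 0 < k. Proof. by rewrite !divr_gt0. Qed.

Let near_fiber (D : R) (x : M) :=
  forall q, cov q = x -> exists2 h, cov h = p & hgap q h <= D.

Let near_fiber_step D x x' : 0 <= D -> near_fiber D x -> mgap x x' < d ->
  near_fiber (4 * (d + D + 2 * d * D)) x'.
Proof.
move=> D0 nx xx' q qx'; rewrite mgap_sym -qx' in xx'.
have [q1 q1x qq1] := cov_onto xx'; have [h hp q1h] := nx _ q1x.
exists h => //; apply: le_trans (hgap_triangle q1 q h) _.
have := hgap_ge0 q q1; have := hgap_ge0 q1 h.
by move: (hgap q q1) (hgap q1 h) qq1 q1h => a b ad bD b0 a0; have := d0; nra.
Qed.

(** The points with some finite [D] form a set stable under moves of size [d], hence open and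
    closed, and it contains [p]. *)
Let near_fiber_ex x : exists2 D, 0 <= D & near_fiber D x.
Proof.
pose A := [set x | exists2 D, 0 <= D & near_fiber D x].
suff : A = [set: M] by move=> /seteqP[_]; exact.
have step y z : A y -> mgap y z < d -> A z.
  move=> [D D0 nD] yz; exists (4 * (d + D + 2 * d * D)); last exact: near_fiber_step D0 nD yz.
  by have := mulr_ge0 (ltW d0) D0; have := d0; lra.
apply: connectedM.
- by exists p, 0 => // q qp; exists q => //; rewrite hgapxx.
- exists A; last by rewrite setTI.
  rewrite openE => y Ay; apply: filterS (nbhs_mgap y d0) => z; exact: step.
- exists A; last by rewrite setTI.
  rewrite -[A]setCK; apply: open_closedC; rewrite openE => y Ay.
  apply: filterS (nbhs_mgap y d0) => z yz Az; apply: Ay; apply: step Az _.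
  by rewrite mgap_sym.
Qed.

(** This is cocompactness: [near_fiber_step] makes each bound valid on a neighbourhood, and
    compactness makes it global. *)
Lemma fiber_dense : exists D, forall q, exists2 h, cov h = p & hgap q h <= D.
Proof.
have : \forall D \near +oo, forall x : M, [set: M] x -> near_fiber D x.
  move/compact_near_coveringP : compactM; apply => x _.
  have [D D0 nD] := near_fiber_ex x.
  exists ([set x' | mgap x x' < d], [set D' | 4 * (d + D + 2 * d * D) <= D']).
    by split; [exact: nbhs_mgap|apply: nbhs_pinfty_ge; exact: num_real].
  move=> [x' D'] /= [xx' DD'] q qx'.
  have [h hp qh] := near_fiber_step D0 nD xx' qx'.
  by exists h => //; exact: le_trans DD'.
by move=> /filter_ex[D nD]; exists D => q; exact: nD.
Qed.

Let finite_net (e : R) : 0 < e -> exists (m : nat) (y : nat -> M),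
  forall x, exists2 i : nat, (i < m)%N & mgap x (y i) < e.
Proof.
move=> e0.
(* Finite lists directed by inclusion: with this filter the near-covering form of compactness yields
   a finite net. *)
pose F : set_system (seq M) := [set A : set (seq M) |
  exists l : seq M, forall l' : seq M, {subset l <= l'} -> A l'].
have FF : Filter F.
  split; first by exists [::].
    move=> A B [l lA] [l' lB]; exists (l ++ l') => l'' ll; split.
      by apply: lA => x xl; apply: ll; rewrite mem_cat xl.
    by apply: lB => x xl; apply: ll; rewrite mem_cat xl orbT.
  by move=> A B AB [l lA]; exists l => l' /lA /AB.
have : \forall l \near F, forall x : M, [set: M] x -> exists2 y, y \in l & mgap x y < e.
  move/compact_near_coveringP : compactM; apply => x _.
  exists ([set x' | mgap x x' < e], [set l : seq M | x \in l]).
    by split; [exact: nbhs_mgap|exists [:: x] => l; apply; rewrite mem_head].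
  by move=> [x' l] /= [xx' xl]; exists x; rewrite // mgap_sym.
move=> [l /(_ l (fun _ => id)) lP].
exists (size l), (nth p l) => x; have [y yl xy] := lP x I.
by exists (index y l); rewrite ?index_mem// nth_index.
Qed.

Let seg_loop (r : R) (a : loop R p) := exists q q', [/\ cov q = p, hgap q q' <= r &
  forall s, s \in `[0, 1] -> a s = cov (hmix s q q')].

(* Up to homotopy, such a loop is determined by the sequence of the points of a
   finite net that it approaches. *)
Let seg_loop_bound (r : R) : exists n : nat, forall a : loop R p, seg_loop r a ->
  (word_length genS (\pi_(pi1 R p) a) <= n)%N.
Proof.
pose e := k / 16 / 16.
have e0 : 0 < e by rewrite !divr_gt0.
have e12 : 16 * e <= 2^-1 by have := d0; have := d12; rewrite /e /k /lift_scale; lra.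
have ed u : u < e -> u < d by have := d0; rewrite /e /k /lift_scale; lra.
have [m [y yP]] := finite_net e0.
have [N0 N0P] := hmix_steps r e0; pose N := N0.+1.
have N0' : 0 < N%:R :> R by rewrite ltr0n.
pose T := {ffun 'I_N.+1 -> 'I_m}.
(* The endpoint [s = 1] falls in cell [N], hence [N.+1] cells. *)
pose ix (s : R) : 'I_N.+1 := inord (Num.truncn (s * N%:R)).
pose track (t : T) (a : loop R p) := forall s, s \in `[0, 1] -> mgap (a s) (y (t (ix s))) < 16 * e.
(* Loops with the same track are uniformly [k]-close, so their lifts end together and they are
   homotopic. One word length then serves the whole track, and there are finitely many tracks. *)
have /choice[f fP] : forall t, exists n : nat, forall a : loop R p, track t a ->
    (word_length genS (\pi_(pi1 R p) a) <= n)%N.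
  move=> t; have [[a ta]|h] := pselect (exists a, track t a); last first.
    by exists 0%N => a ta; exfalso; apply: h; exists a.
  exists (word_length genS (\pi_(pi1 R p) a)) => b tb.
  have [q qa] := lift_end_ex d0 d12 cov_iso cov_onto a covo.
  have [q' qb] := lift_end_ex d0 d12 cov_iso cov_onto b covo.
  suff -> : \pi_(pi1 R p) b = \pi_(pi1 R p) a by [].
  apply/pi1P; suff qq' : q' = q by rewrite qq' in qb; apply: (homotopic_lift_end d0 cov_iso qb qa).
  apply: (lift_end_close d0 d12 cov_iso qb qa) => s s01.
  rewrite -/k (_ : k = 16 * (16 * e)); last by rewrite /e; lra.
  apply: (@mgap_triangle_small _ _ (y (t (ix s)))) => //; first exact: tb.
  by rewrite mgap_sym; exact: ta.
exists (\max_t f t) => a [q [q' [qp qq' aE]]].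
have /choice[t tP] : forall j : 'I_N.+1, exists i : 'I_m,
    mgap (cov (hmix (j%:R / N%:R) q q')) (y i) < e.
  by move=> j; have [i im iy] := yP (cov (hmix (j%:R / N%:R) q q')); exists (Ordinal im).
suff ta : track (finfun t) a by exact: leq_trans (fP _ _ ta) (leq_bigmax _).
move=> s s01; have /andP[s0 s1] : 0 <= s <= 1 by move: s01; rewrite in_itv.
rewrite aE//.
have sN0 : 0 <= s * N%:R by rewrite mulr_ge0.
have /andP[l1 l2] := truncn_itv sN0.
have jN : (Num.truncn (s * N%:R) < N.+1)%N.
  rewrite ltnS -(ler_nat R); apply: le_trans l1 _.
  by rewrite -[leRHS]mul1r ler_wpM2r// ltW.
have sj : `|s - (ix s)%:R / N%:R| <= N%:R^-1.
  rewrite /ix inordK// -(ler_pM2r N0') -[X in _ * X](gtr0_norm N0') -normrM.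
  rewrite mulrBl divfK ?gt_eqF// mulVf ?gt_eqF// ler_norml.
  by apply/andP; split; rewrite -natr1 in l2; lra.
rewrite ffunE; have e1 : e <= 2^-1 by have := e0; lra.
apply: (@mgap_triangle_small _ _ (cov (hmix ((ix s)%:R / N%:R) q q')) _ _ _ e1); last exact: tP.
have st : hgap (hmix s q q') (hmix ((ix s)%:R / N%:R) q q') < e by exact: N0P.
by rewrite cov_iso//; exact: ed.
Qed.

(** Density is that of the fibre over [p]. For properness, [g^-1 * h] is the class of the projected
    segment from [phi g] to [phi h], to which [seg_loop_bound] applies. *)
Lemma orbit_map : exists phi : pi1 R p -> hyp3 R,
  (exists D, forall q, exists g, hgap (phi g) q <= D) /\
  (forall r, exists n : nat, forall g h, hgap (phi g) (phi h) <= r ->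
    (word_length genS (g^-1 * h)%g <= n)%N).
Proof.
have /choice[phi phiP] : forall g : pi1 R p, exists q, lift_end (cov := cov) o (repr g) q.
  by move=> g; exact: (lift_end_ex d0 d12 cov_iso cov_onto (repr g) covo).
exists phi; split.
  have [D DP] := fiber_dense; exists D => q.
  have [h hp qh] := DP q.
  have [a [oa _]] := segment_loop d0 cov_iso covo hp.
  exists (\pi_(pi1 R p) a).
  suff -> : phi (\pi_(pi1 R p) a) = h by rewrite hgap_sym.
  apply: (lift_end_homotopic d0 d12 cov_iso cov_onto (phiP _) oa).
  exact: repr_pi1.
move=> r; have [n nP] := seg_loop_bound r; exists n => g h gh.
have pg := lift_end_fiber (phiP g); have ph := lift_end_fiber (phiP h).
have [a [gah aE]] := segment_loop d0 cov_iso pg ph.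
suff -> : (g^-1 * h)%g = \pi_(pi1 R p) a by apply: nP; exists (phi g), (phi h).
suff -> : h = (g * \pi_(pi1 R p) a)%g by rewrite mulKg.
have oh := lift_end_cat d0 d12 cov_iso cov_onto (phiP g) gah.
rewrite -[LHS]reprK -[X in (X * _)%g]reprK [RHS]pi1_mulE; apply/pi1P.
exact: (homotopic_lift_end d0 cov_iso (phiP h) oh).
Qed.

End OrbitMap.

(** * The action *)

(** The last clause is what matters: each point is matched by [f] or by [g], so the bijection
    inherits their displacement bounds. *)
Lemma pointwise_bernstein (A B : Type) (f : A -> B) (g : B -> A) :
  injective f -> injective g -> exists (h : A -> B) (h' : B -> A),
  [/\ cancel h h', cancel h' h & forall a, h a = f a \/ a = g (h a)].
Proof.
move=> fi gi.
(* The orbits under [g \o f] of the points outside the image of [g]: [f] is used there, and the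
   inverse of [g] elsewhere. *)
pose C (a : A) := exists (n : nat) (a0 : A),
  a = iter n (fun x => g (f x)) a0 /\ ~ exists b, a0 = g b.
have /choice[h hP] : forall a, exists b, (C a /\ b = f a) \/ (~ C a /\ a = g b).
  move=> a; have [Ca|nCa] := pselect (C a); first by exists (f a); left.
  have [[b ab]|nb] := pselect (exists b, a = g b); first by exists b; right.
  by exfalso; apply: nCa; exists 0%N, a.
have hi : injective h.
  have mixed a a' : C a -> ~ C a' -> f a = h a' -> a' = g (h a') -> False.
    move=> [n [a0 [aE a0P]]] nCa' fah a'E; apply: nCa'.
    by exists n.+1, a0; split=> //=; rewrite -aE fah.
  move=> a a' haa'; case: (hP a) => [[Ca ha]|[nCa ha]];
    case: (hP a') => [[Ca' ha']|[nCa' ha']].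
  - by apply: fi; rewrite -ha -ha'.
  - by exfalso; apply: (mixed a a'); rewrite -?ha.
  - by exfalso; apply: (mixed a' a); rewrite -?ha'.
  - by rewrite ha ha' haa'.
have hs b : exists a, h a = b.
  have [Cb|nCb] := pselect (C (g b)); last first.
    by exists (g b); case: (hP (g b)) => [[]//|[_ /gi]].
  have [[|n] [a0 [gE a0P]]] := Cb; first by exfalso; apply: a0P; exists b.
  move/gi: gE => ->; exists (iter n (fun x => g (f x)) a0).
  case: (hP (iter n (fun x => g (f x)) a0)) => [[]//|[nC _]].
  by exfalso; apply: nC; exists n, a0.
have [h' hK] := choice hs.
exists h, h'; split=> // [a|a]; first by apply: hi; rewrite hK.
by case: (hP a) => [[_ ?]|[_ ?]]; [left|right].
Qed.

(** * The horospherical net *)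

Section HorosphericNet.
Context {R : realType} (c : R) (l : nat).
Context (c0 : 0 < c) (l1 : (1 < l)%N).

Definition net_height (k : int) : R := l%:R ^ k.

Let lR0 : 0 < l%:R :> R. Proof. by rewrite ltr0n ltnW. Qed.

Lemma net_height_gt0 k : 0 < net_height k.
Proof. by rewrite exprz_gt0. Qed.

Lemma net_heightD k m : net_height (k + m) = net_height k * net_height m.
Proof. by rewrite /net_height expfzDr// gt_eqF. Qed.

(* Each level [z = l ^ k] is a horosphere, on which [Z * Z] acts with
   displacement independent of [k]. *)
Definition net_point (i : (int * int) * int) : hyp3 R :=
  Hyp3 (c * i.1.1%:~R * net_height i.2) (c * i.1.2%:~R * net_height i.2)
    (net_height_gt0 i.2).

Lemma hgap_net_level (a b a' b' k : int) :
  hgap (net_point ((a, b), k)) (net_point ((a', b'), k)) =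
  c ^+ 2 * ((a - a')%:~R ^+ 2 + (b - b')%:~R ^+ 2) / 2.
Proof.
apply/hgap_eq; rewrite /= subrr expr0n /= addr0 !rmorphB /=.
by move: (net_height k) => z; field.
Qed.

(** Heights of distinct levels have ratio at least [l], too large for [hgap_height]; distinct points
    of one level have gap at least [c ^+ 2 / 2]. *)
Lemma net_separated (K : R) : 2 * K < c ^+ 2 -> 2 * (1 + K) < l%:R ->
  forall i j, hgap (net_point i) (net_point j) <= K -> i = j.
Proof.
move=> cK lK.
have level (k k' : int) x y x' y' : hgap (net_point ((x, y), k)) (net_point ((x', y'), k')) <= K ->
    k <= k'.
  move=> h; rewrite leNgt; apply/negP => kk'.
  have := hgap_height (net_point ((x, y), k)) (net_point ((x', y'), k')).
  have : l%:R * net_height k' <= net_height k.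
    have -> : l%:R * net_height k' = net_height (k' + 1) by rewrite net_heightD mulrC.
    rewrite /net_height ler_eXz2l ?ltr1n//; lia.
  have z0 := net_height_gt0 k'.
  move=> /= h1 h2; have := le_trans h1 h2; rewrite ler_pM2r// => h3; lra.
move=> [[a b] k] [[a' b'] k'] h.
have kk : k = k'.
  by apply/eqP; rewrite eq_le (level _ _ _ _ _ _ h) (level k' k a' b' a b)// hgap_sym.
rewrite -{k'}kk hgap_net_level in h *.
have sq1 (u : int) : u != 0 -> 1 <= (u%:~R : R) ^+ 2.
  move=> u0; rewrite -rmorphXn /= ler1z; rewrite -gtz0_ge1.
  by rewrite lt_neqAle sqr_ge0 andbT eq_sym expf_neq0.
have cc : 0 < c ^+ 2 by rewrite exprn_gt0.
have sum0 : (a - a')%:~R ^+ 2 + (b - b')%:~R ^+ 2 < 1 :> R.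
  rewrite -(ltr_pM2l cc); lra.
have sa := sqr_ge0 ((a - a')%:~R : R); have sb := sqr_ge0 ((b - b')%:~R : R).
have -> : a = a'.
  by have [|/sq1 ?] := eqVneq (a - a') 0; [lia|exfalso; lra].
have -> : b = b'.
  by have [|/sq1 ?] := eqVneq (b - b') 0; [lia|exfalso; lra].
by [].
Qed.

Lemma net_height_floor (z : R) : 0 < z -> exists k, net_height k <= z < l%:R * net_height k.
Proof.
move=> z0; have l0 : 0 < ln (l%:R : R) by rewrite ln_gt0// ltr1n.
have LE (k : int) : net_height k = expR (k%:~R * ln (l%:R : R)).
  case: k => n; rewrite /net_height.
    by rewrite -exprnP -[_%:~R]/(n%:R) expRM_natl lnK// posrE.
  by rewrite NegzE rmorphN /= mulNr expRN -exprnN expRM_natl lnK// posrE.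
pose k := Num.floor (ln z / ln (l%:R : R)).
exists k; rewrite -[z in _ <= z < _]lnK ?posrE// LE.
have -> : l%:R * expR (k%:~R * ln l%:R) = expR ((k + 1)%:~R * ln (l%:R : R)).
  by rewrite rmorphD /= mulrDl mul1r expRD lnK ?posrE// mulrC.
have /andP[h1 h2] := floor_itv (ln z / ln (l%:R : R)).
rewrite ler_expR ltr_expR; apply/andP; split.
  by rewrite -ler_pdivlMr.
by rewrite -ltr_pdivrMr.
Qed.

Lemma net_dense : exists D : R, forall q, exists i, hgap q (net_point i) <= D.
Proof.
exists ((2 * c ^+ 2 + l%:R ^+ 2) / 2) => q.
have [k /andP[kz zk]] := net_height_floor (hyp3_z_gt0 q).
have L0 := net_height_gt0 k.
have cL : 0 < c * net_height k by rewrite mulr_gt0.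
have round (x : R) : exists a : int, (x - c * a%:~R * net_height k) ^+ 2 <= (c * net_height k) ^+ 2.
  exists (Num.floor (x / (c * net_height k))).
  have /andP[h1 h2] := floor_itv (x / (c * net_height k)).
  rewrite rmorphD /= in h2; move: h1 h2; set a := _%:~R => h1 h2.
  rewrite ler_pdivlMr// in h1; rewrite ltr_pdivrMr// mulrDl mul1r in h2.
  rewrite (_ : c * a * _ = a * (c * net_height k)); last by ring.
  rewrite ler_sqr ?nnegrE ?(ltW cL)//; lra.
have [a aP] := round (hyp3_x q); have [b bP] := round (hyp3_y q).
exists ((a, b), k); rewrite hgap_le /=.
have hz : (hyp3_z q - net_height k) ^+ 2 <= (l%:R * net_height k) ^+ 2.
  by rewrite ler_sqr ?nnegrE ?mulr_ge0 ?(ltW L0)//; lra.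
have := ler_wpM2r (ltW L0) kz; move: (net_height k) L0 kz aP bP hz => L L0 kz aP bP hz LL.
apply: (@le_trans _ _ ((2 * c ^+ 2 + l%:R ^+ 2) * (L * L))); first by lra.
have C0 : 0 <= 2 * c ^+ 2 + l%:R ^+ 2 by have := sqr_ge0 c; have := sqr_ge0 (l%:R : R); lra.
by have := ler_wpM2l C0 LL; lra.
Qed.

(** Multiplying the integer coordinates by [l ^ m] keeps the horizontal position when descending [m]
    levels. Offsets [n < l ^ m] along the first axis then give distinct children, recovered by
    division with remainder. *)
Definition net_child (m : nat) (i : (int * int) * int) (n : nat) : (int * int) * int :=
  ((i.1.1 * (l ^ m)%:Z + n%:Z, i.1.2 * (l ^ m)%:Z), i.2 - m%:Z).

Lemma net_child_inj m i j n n' : (n < l ^ m)%N -> (n' < l ^ m)%N ->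
  net_child m i n = net_child m j n' -> i = j /\ n = n'.
Proof.
case: i j => [[a b] k] [[a' b'] k'] nl n'l [] e1 e2 e3.
have lm : (0 < l ^ m)%N by rewrite expn_gt0 ltnW.
have kk : k = k' by lia.
move: (l ^ m)%N lm nl n'l e1 e2 => L L0 nL n'L e1 e2.
have bb : b = b' by apply: (mulIf (x := L%:Z)); [lia|].
have aa : a = a' by nia.
by rewrite kk bb aa; split=> //; rewrite aa in e1; lia.
Qed.

Lemma hgap_net_child m : exists D : R, forall i n, (n < l ^ m)%N ->
  hgap (net_point i) (net_point (net_child m i n)) <= D.
Proof.
exists ((c ^+ 2 + 1) * (l ^ m)%:R / 2) => -[[a b] k] n nl.
rewrite hgap_le /=.
have kE : net_height k = (l ^ m)%:R * net_height (k - m%:Z).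
  have := net_heightD (k - m%:Z) m%:Z; rewrite subrK mulrC => ->.
  by congr (_ * _); rewrite /net_height natrX.
rewrite kE; have := net_height_gt0 (k - m%:Z); move: (net_height _) => z z0 {kE}.
have nL : (n%:R : R) <= (l ^ m)%:R by rewrite ler_nat ltnW.
have n0 : (0 : R) <= n%:R by [].
have L1 : (1 : R) <= (l ^ m)%:R by rewrite ler1n expn_gt0 ltnW.
rewrite !rmorphD !rmorphM /= -!pmulrn.
move: (l ^ m)%:R n%:R nL n0 L1 => L n' nL n0 L1.
rewrite (_ : c * a%:~R * (L * z) - c * (a%:~R * L + n') * z = - (c * n' * z)); last by ring.
rewrite (_ : c * b%:~R * (L * z) - c * (b%:~R * L) * z = 0); last by ring.
rewrite sqrrN expr0n /= addr0.
have cz : 0 < c * z by rewrite mulr_gt0.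
have h1 : (c * n' * z) ^+ 2 <= (c * L * z) ^+ 2.
  rewrite ![c * _ * z]mulrAC ler_sqr ?nnegrE ?(mulr_ge0 (ltW cz))//; last by lra.
  by rewrite ler_pM2l.
have Lz : z <= L * z by rewrite ler_peMl// ltW.
have h2 : (L * z - z) ^+ 2 <= (L * z) ^+ 2 by rewrite ler_sqr ?nnegrE; lra.
by lra.
Qed.

End HorosphericNet.

(** * Transporting the translations of the net to the group *)

Section TranslationLikeAction.
Context {R : realType} {G : groupType} {S : seq G} (genS : generates S).
Context {phi : G -> hyp3 R} {D : R}.
Context (phi_dense : forall q, exists g, hgap (phi g) q <= D)
  (phi_proper : forall r : R, exists n : nat, forall g h,
    hgap (phi g) (phi h) <= r -> (word_length genS (g^-1 * h)%g <= n)%N).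
Local Notation idx := ((int * int) * int)%type.

Let gap_bound (a b : R) : exists e : R, forall p q r : hyp3 R,
  hgap p q <= a -> hgap q r <= b -> hgap p r <= e.
Proof.
exists (4 * (a + b + 2 * a * b)) => p q r pq qr; apply: le_trans (hgap_triangle q p r) _.
have := hgap_ge0 p q; have := hgap_ge0 q r.
by move: (hgap p q) (hgap q r) pq qr => u v ua vb v0 u0; nra.
Qed.

(** By properness each fibre of [r] lies in a word ball of fixed radius about a representative, and
    such balls have bounded cardinality. *)
Let bounded_fibers (T : Type) (r : G -> T) (e : R) :
  (forall g h, r g = r h -> hgap (phi g) (phi h) <= e) ->
  exists (N : nat) (num : G -> nat), (forall g, (num g < N)%N) /\
    forall g h, r g = r h -> num g = num h -> g = h.
Proof.
move=> re; have [n nP] := phi_proper e.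
have [N NP] := word_ball_card genS n.
have /choice[f fP] : forall x : G, exists f : G -> nat,
    (forall y, (word_length genS (x^-1 * y)%g <= n)%N -> (f y < N)%N) /\
    forall y z, (word_length genS (x^-1 * y)%g <= n)%N ->
      (word_length genS (x^-1 * z)%g <= n)%N -> f y = f z -> y = z.
  move=> x; have /pcard_leP[f] := NP x.
  exists f; split=> [y yn|y z yn zn].
    exact: (@funS _ _ _ _ f y yn).
  by apply: (@inj _ _ _ f); rewrite inE.
have /choice[rep repP] : forall t : T, exists x : G, forall g, r g = t -> r x = t.
  move=> t; have [[x xt]|h] := pselect (exists x, r x = t); first by exists x.
  by exists 1%g => g gt; exfalso; apply: h; exists g.
have near g : (word_length genS ((rep (r g))^-1 * g)%g <= n)%N.
  by apply: nP; apply: re; rewrite (repP _ g).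
exists N, (fun g => f (rep (r g)) g); split=> [g|g h rgh].
  by have [fN _] := fP (rep (r g)); exact: fN.
rewrite -rgh => e1; have [_ fI] := fP (rep (r g)).
by apply: fI => //; rewrite rgh.
Qed.

(** Each group element goes to a child of a net point near its orbit point, numbered within its
    fibre; each net point goes to a group element with nearby orbit point. Both maps are injective
    and of bounded displacement. *)
Let net_bijection : exists (c : R) (l : nat) (l1 : (1 < l)%N) (psi : G -> idx)
  (psi' : idx -> G) (e : R), [/\ cancel psi psi', cancel psi' psi &
    forall g, hgap (phi g) (net_point c l1 (psi g)) <= e].
Proof.
have [K KP] := gap_bound D D.
have [c c0 cK] : exists2 c : R, 0 < c & 2 * K < c ^+ 2.
  exists (1 + `|2 * K|); first by have := normr_ge0 (2 * K); lra.
  by have := normr_ge0 (2 * K); have := ler_norm (2 * K); nra.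
(* The double successor makes [l] exceed both 1 and [2 * (1 + K)]. *)
pose l := (Num.truncn (2 * (1 + K))).+2.
have l1 : (1 < l)%N by [].
have lK : 2 * (1 + K) < l%:R.
  by apply: lt_trans (truncnS_gt _) _; rewrite ltr_nat.
have [j jP] := choice (fun i => phi_dense (net_point c l1 i)).
have ji : injective j.
  move=> i i' ii'; apply: (net_separated c0 cK lK); apply: KP (jP i').
  by rewrite -ii' hgap_sym.
have [D2 D2P] := net_dense c0 l1; have [r rP] := choice (fun g => D2P (phi g)).
have [e1 e1P] := gap_bound D2 D2.
have [|N [num [numN num_inj]]] := @bounded_fibers _ r e1.
  by move=> g h gh; apply: e1P (rP g) _; rewrite gh hgap_sym.
(* As [N < l ^ N], descending [N] levels gives enough children. *)
have numl g : (num g < l ^ N)%N by apply: ltn_trans (numN g) (ltn_expl _ _).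
have [D3 D3P] := hgap_net_child c0 l1 N.
pose f g := net_child l N (r g) (num g).
have fi : injective f.
  by move=> g h /(net_child_inj c0 l1 (numl g) (numl h))[]; exact: num_inj.
have [e2 e2P] := gap_bound D2 D3.
have [psi [psi' [psiK psiK' psiP]]] := pointwise_bernstein fi ji.
exists c, l, l1, psi, psi', (Num.max D e2); split=> // g.
(* Points matched by [f] contribute [e2], those matched by [j] contribute [D]. *)
rewrite le_max; case: (psiP g) => [->|{1}->]; last by rewrite jP.
by rewrite (e2P _ _ _ (rP g) (D3P _ _ (numl g))) orbT.
Qed.

Lemma translation_like_int2 : exists act : Algebra.to_multiplicative (int * int) ->
  word_space R genS -> word_space R genS, translation_like act.
Proof.
have [c [l [l1 [psi [psi' [e [psiK psiK' psiP]]]]]]] := net_bijection.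
pose tr (v : int * int) (i : idx) : idx := ((v.1 + i.1.1, v.2 + i.1.2), i.2).
pose act (v : Algebra.to_multiplicative (int * int)) (g : word_space R genS) :
  word_space R genS := psi' (tr v (psi g)).
exists act; split.
- move=> g; rewrite /act (_ : tr _ _ = psi g) ?psiK//.
  by case: (psi g) => [[a b] k]; rewrite /tr /= !add0r.
- move=> v w g; rewrite /act psiK'; congr psi'.
  by case: (psi g) => [[a b] k]; rewrite /tr /= !addrA.
- move=> g v /(congr1 psi); rewrite /act psiK'.
  case: (psi g) => [[a b] k]; case: v => [x y] [] /= e1 e2.
  by have -> : x = 0 by [lia]; have -> : y = 0 by lia.
move=> v.
(* The gap between a net point and its translate by [v], the same at all points and levels by
   [hgap_net_level]. *)
pose D1 : R := c ^+ 2 * (v.1%:~R ^+ 2 + v.2%:~R ^+ 2) / 2.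
have [e1 e1P] := gap_bound e D1; have [e2 e2P] := gap_bound e1 e.
have [n nP] := phi_proper e2.
have bound g : word_dist g (act v g) <= n%:R.
  rewrite ler_nat; apply: nP; apply: (e2P _ (net_point c l1 (psi (act v g)))).
    apply: e1P (psiP g) _; rewrite /act psiK'.
    case: (psi g) => [[a b] k]; rewrite hgap_net_level /D1 /= !opprD.
    rewrite ![_ + (- _ - _)]addrCA !subrr !addr0.
    by rewrite !rmorphN /= !sqrrN.
  by rewrite hgap_sym.
exists n%:R; split; first exact: num_real.
move=> m nm _ [g _ <-]; rewrite /= ger0_norm ?mdist_ge0//.
exact: le_trans (bound g) (ltW nm).
Qed.

End TranslationLikeAction.

Theorem theorem1p1 (R : realType) (M : metricType R)
    (hypM : closed_hyperbolic_3manifold M) (p : M)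
    (S : seq (pi1 R p)) (genS : generates S) :
  exists act : Algebra.to_multiplicative (int * int) ->
               word_space R genS -> word_space R genS,
    translation_like act.
Proof.
have [compactM connectedM locM] := hypM.
have [e [e0 e12 [F FP]]] := uniform_charts compactM locM.
have [cov [o [d [d0 d12 covo cov_iso cov_onto]]]] := developed_covering e0 e12 FP p.
have [phi [[D phi_dense] phi_proper]] :=
  orbit_map genS d0 d12 covo cov_iso cov_onto compactM connectedM.
exact: translation_like_int2 phi_dense phi_proper.
Qed.
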